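(* Let $A,B,C$ be $n\times n$ complex matrices such that the $2n\times 2n$ matrix $\begin{pmatrix} A & B^* \\ B & C \end{pmatrix}$ is Hermitian. Then, for every symmetric norm $\|\cdot\|$ and every $0\le p\le 1$, $$ \left\|\,\left|\begin{pmatrix} A & B^* \\ B & C \end{pmatrix}\right|^p\,\right\|\le\left\|\,|A|^p+|B|^p+|B^*|^p+|C|^p\,\right\|. $$
   Context: For a complex matrix $X$, $|X|=(X^*X)^{1/2}$, and $|X|^p$ is defined by applying the function $f(t)=t^p$ to $|X|$ via the functional calculus. A symmetric (or unitarily invariant) norm is a norm on complex matrices satisfying $\|X\|=\|UXV\|$ for all $X$ and all unitaries $U,V$. Here the symmetric norm is a norm on the $2n\times 2n$ matrices, and an $n\times n$ matrix $Y$ is identified with $\begin{pmatrix} Y & 0 \\ 0 & 0 \end{pmatrix}$ (padding with zeros) when its norm is taken. *)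

(* Defs.v *)
From mathcomp Require Import all_boot all_order all_algebra.
From mathcomp Require Import all_classical all_reals all_analysis.
From mathcomp Require Export complex.

Set Implicit Arguments.
Unset Strict Implicit.
Unset Printing Implicit Defensive.

Import Order.TTheory GRing.Theory Num.Theory.
Local Open Scope ring_scope.
Local Open Scope complex_scope.
Local Open Scope sesquilinear_scope.

(* f(H) for a Hermitian H: if H = P^-1 diag(l_1, .., l_n) P with P unitary
   then f(H) = P^-1 diag(f l_1, .., f l_n) P. The l_i are real (see
   hermitian_spectral_diag_real), so that taking their real part only serves
   to type f as a function on R. The value is meaningful for Hermitian H only. *)
Definition funcalc (R : realType) (n : nat) (f : R -> R) (H : 'M[R[i]]_n) :
    'M[R[i]]_n :=
  invmx (spectralmx H)
    *m diag_mx (map_mx (fun z => (f (complex.Re z))%:C) (spectral_diag H))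
    *m spectralmx H.

Definition absmx (R : realType) (n : nat) (X : 'M[R[i]]_n) : 'M[R[i]]_n :=
  funcalc Num.sqrt (X^t* *m X).

(* |X|^p; since 0 `^ 0 = 1, |X|^0 is the identity matrix. *)
Definition abspowmx (R : realType) (n : nat) (p : R) (X : 'M[R[i]]_n) :
    'M[R[i]]_n :=
  funcalc (fun t => t `^ p) (absmx X).

Definition is_norm (R : realType) (m : nat) (N : 'M[R[i]]_m -> R) : Prop :=
  [/\ forall X, 0 <= N X,
      forall X, N X = 0 -> X = 0,
      forall (c : R[i]) X, (N (c *: X))%:C = `|c| * (N X)%:C
    & forall X Y, N (X + Y) <= N X + N Y].

Definition symmetric_norm (R : realType) (m : nat) (N : 'M[R[i]]_m -> R) :
    Prop :=
  is_norm N /\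
  forall U X V : 'M[R[i]]_m, U \is unitarymx -> V \is unitarymx ->
    N (U *m X *m V) = N X.

Definition padmx (R : realType) (n : nat) (Y : 'M[R[i]]_n) :
    'M[R[i]]_(n + n) :=
  block_mx Y 0 0 0.

(* Main.v *)
Require Import Defs.
From HB Require Import structures.
From mathcomp Require Import all_boot all_order all_algebra.
From mathcomp Require Import all_classical all_reals all_analysis.
From mathcomp Require Import fingroup perm ring lra.

Import Order.TTheory GRing.Theory Num.Theory.
Local Open Scope ring_scope.
Local Open Scope complex_scope.
Local Open Scope sesquilinear_scope.

Set Implicit Arguments.
Unset Strict Implicit.
Unset Printing Implicit Defensive.

(** By Fan dominance it suffices to compare weak majorizations, here in the
    form [excess s X <= excess s Y] for all [s >= 0], where [excess s X] is the
    trace of [(X - s)_+], the maximum of [tr (D (X - s))] over [0 <= D <= 1].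
    The case [p = 0] is direct since [|X|^0] is the identity.

    Write the block matrix as [S + T] with [S] block diagonal and [T] block
    antidiagonal, both Hermitian. Then [S + T = P - Q] with [P = S_+ + T_+] and
    [Q = S_- + T_-], and Weyl's monotonicity bounds the excess of [|S + T|^p] by
    the sum of those of [P^p] and [Q^p]. The Ando-Zhan inequality bounds
    [(S_+ + T_+)^p] by [S_+^p + T_+^p], and likewise for [Q]; superadditivity of
    the excess on positive matrices then gives [|S|^p + |T|^p], which is block
    diagonal with blocks [|A|^p + |B|^p] and [|C|^p + |B^*|^p], and applied once
    more it gives the sum of these two blocks.

    Ando-Zhan for [0 < p <= 1], where [t^p = t t^(p-1)]: if [E] is a spectral
    projection of [Z = A + B] for its largest eigenvalues and
    [G = (Z + eps)^(p-1)], then [E] and [G] are oppositely ordered functions of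
    [Z], so that [tr (E G A) <= tr (E A^(1/2) G A^(1/2))], and
    [G <= (A + eps)^(p-1)] by the Loewner-Heinz inequality. *)

(** * Adjoints of complex matrices *)

Section Adjoint.
Variable C : numClosedFieldType.

Lemma adjmxM m n p (A : 'M[C]_(m, n)) (B : 'M[C]_(n, p)) :
  (A *m B)^t* = B^t* *m A^t*.
Proof. by rewrite trmx_mul map_mxM. Qed.

Lemma adjmxD m n (A B : 'M[C]_(m, n)) : (A + B)^t* = A^t* + B^t*.
Proof. by rewrite linearD map_mxD. Qed.

Lemma adjmxN m n (A : 'M[C]_(m, n)) : (- A)^t* = - (A^t*).
Proof. by rewrite linearN map_mxN. Qed.

Lemma adjmxB m n (A B : 'M[C]_(m, n)) : (A - B)^t* = A^t* - (B^t*).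
Proof. by rewrite adjmxD adjmxN. Qed.

Lemma adjmx1 n : (1%:M : 'M[C]_n)^t* = 1%:M.
Proof. by rewrite trmx1 map_mx1. Qed.

Lemma adjmx_block m1 m2 n1 n2 (A : 'M[C]_(m1, n1)) (B : 'M[C]_(m1, n2))
    (D : 'M[C]_(m2, n1)) (E : 'M[C]_(m2, n2)) :
  (block_mx A B D E)^t* = block_mx (A^t*) (D^t*) (B^t*) (E^t*).
Proof. by rewrite tr_block_mx map_block_mx. Qed.

Lemma unitarymxK n (U : 'M[C]_n) : U \is unitarymx -> U^t* *m U = 1%:M.
Proof. by move=> /unitarymxP; exact: mulmx1C. Qed.

Lemma hermsymmxP n (X : 'M[C]_n) : reflect (X^t* = X) (X \is hermsymmx).
Proof.
by apply: (iffP (is_hermitianmxP _ _ _)); rewrite expr0 scale1r => /esym.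
Qed.

Lemma mulmx_adj_row n (u : 'rV[C]_n) :
  (u *m u^t*) 0 0 = \sum_i `|u 0 i| ^+ 2.
Proof. by rewrite mxE; apply: eq_bigr => i _; rewrite !mxE normCK. Qed.

End Adjoint.

(** * Positive semidefinite matrices *)

Section Psd.
Variable C : numClosedFieldType.

Definition psdmx n (X : 'M[C]_n) : Prop :=
  X^t* = X /\ forall v : 'rV[C]_n, 0 <= (v *m X *m v^t*) 0 0.

Lemma psd_herm n (X : 'M[C]_n) : psdmx X -> X^t* = X.
Proof. by case. Qed.

Lemma psdmxD n (X Y : 'M[C]_n) : psdmx X -> psdmx Y -> psdmx (X + Y).
Proof.
move=> [hX pX] [hY pY]; split; first by rewrite adjmxD hX hY.
by move=> v; rewrite mulmxDr mulmxDl mxE addr_ge0.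
Qed.

Lemma psdmx0 n : psdmx (0 : 'M[C]_n).
Proof. by split=> [|v]; rewrite ?trmx0 ?map_mx0// mulmx0 mul0mx mxE. Qed.

Lemma psdmx1 n : psdmx (1%:M : 'M[C]_n).
Proof.
split=> [|v]; first exact: adjmx1.
by rewrite mulmx1 mulmx_adj_row sumr_ge0// => i _; rewrite exprn_ge0.
Qed.

Lemma psdmx_conj m n (W : 'M[C]_(n, m)) (X : 'M[C]_n) :
  psdmx X -> psdmx (W^t* *m X *m W).
Proof.
move=> [hX pX]; split; first by rewrite !adjmxM trmxCK hX mulmxA.
move=> v; have := pX (v *m W^t*).
by rewrite adjmxM trmxCK !mulmxA.
Qed.

Lemma psdmx_gram m n (W : 'M[C]_(m, n)) : psdmx (W^t* *m W).
Proof. by rewrite -[X in X *m _]mulmx1; apply: psdmx_conj; exact: psdmx1. Qed.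

Lemma psdmx_diag n (X : 'M[C]_n) i : psdmx X -> 0 <= X i i.
Proof.
move=> [_ /(_ (delta_mx 0 i))]; rewrite -rowE.
suff -> : (row i X *m (delta_mx 0 i : 'rV_n)^t*) 0 0 = X i i by [].
rewrite mxE (bigD1 i)//= big1 ?addr0 => [|j ji].
  by rewrite !mxE !eqxx rmorph1 mulr1.
by rewrite !mxE (negbTE ji) andbF rmorph0 mulr0.
Qed.

Lemma psdmx_trace_ge0 n (X : 'M[C]_n) : psdmx X -> 0 <= \tr X.
Proof. by move=> pX; rewrite /mxtrace sumr_ge0// => i _; exact: psdmx_diag. Qed.

Lemma psdmx_block m n (X : 'M[C]_m) (Y : 'M[C]_n) :
  psdmx X -> psdmx Y -> psdmx (block_mx X 0 0 Y).
Proof.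
move=> [hX pX] [hY pY]; split.
  by rewrite adjmx_block hX hY !trmx0 !map_mx0.
move=> v; rewrite -[v]hsubmxK mul_row_block !mulmx0 addr0 add0r.
by rewrite tr_row_mx map_col_mx mul_row_col mxE addr_ge0.
Qed.

End Psd.

(** * Spectral decompositions and functional calculus *)

Definition rdiag_mx (R : realType) n (l : 'I_n -> R) : 'M[R[i]]_n :=
  diag_mx (\row_i (l i)%:C).

(** For unitary [U] the rows of [U] are left eigenvectors with eigenvalues [l]; functions of one
    Hermitian matrix are then computed pointwise on [l]. *)
HB.lock Definition decmx (R : realType) n (U : 'M[R[i]]_n) (l : 'I_n -> R) :
    'M[R[i]]_n :=
  U^t* *m rdiag_mx l *m U.

Section Spectral.
Variable R : realType.
Notation C := R[i].

Lemma conj_real_complex (x : R) : Num.conj (x%:C : C) = x%:C.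
Proof. by apply/CrealP; rewrite complex_real. Qed.

Lemma rdiag_mx_adj n (l : 'I_n -> R) : (rdiag_mx l)^t* = rdiag_mx l.
Proof.
rewrite /rdiag_mx tr_diag_mx map_diag_mx; congr diag_mx.
by apply/rowP => i; rewrite !mxE; exact: conj_real_complex.
Qed.

Lemma rdiag_mxD n (l m : 'I_n -> R) :
  rdiag_mx l + rdiag_mx m = rdiag_mx (fun i => l i + m i).
Proof. by apply/matrixP => i j; rewrite !mxE -mulrnDl rmorphD. Qed.

Lemma rdiag_mxN n (l : 'I_n -> R) : - rdiag_mx l = rdiag_mx (fun i => - l i).
Proof. by apply/matrixP => i j; rewrite !mxE rmorphN mulNrn. Qed.

Lemma rdiag_mxM n (l m : 'I_n -> R) :
  rdiag_mx l *m rdiag_mx m = rdiag_mx (fun i => l i * m i).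
Proof.
rewrite /rdiag_mx mulmx_diag; congr diag_mx.
by apply/rowP => i; rewrite !mxE rmorphM.
Qed.

Lemma eq_decmx n (U : 'M[C]_n) (l m : 'I_n -> R) :
  l =1 m -> decmx U l = decmx U m.
Proof. by move=> /funext ->. Qed.

Lemma decmx_adj n (U : 'M[C]_n) l : (decmx U l)^t* = decmx U l.
Proof. by rewrite decmx.unlock !adjmxM trmxCK rdiag_mx_adj mulmxA. Qed.

Lemma decmxD n (U : 'M[C]_n) l m :
  decmx U l + decmx U m = decmx U (fun i => l i + m i).
Proof. by rewrite decmx.unlock -mulmxDl -mulmxDr rdiag_mxD. Qed.

Lemma decmxN n (U : 'M[C]_n) l : - decmx U l = decmx U (fun i => - l i).
Proof. by rewrite decmx.unlock -mulNmx -mulmxN rdiag_mxN. Qed.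

Lemma decmxB n (U : 'M[C]_n) l m :
  decmx U l - decmx U m = decmx U (fun i => l i - m i).
Proof. by rewrite decmxN decmxD. Qed.

Lemma decmxM n (U : 'M[C]_n) l m : U \is unitarymx ->
  decmx U l *m decmx U m = decmx U (fun i => l i * m i).
Proof.
move=> /unitarymxP uU; rewrite decmx.unlock -rdiag_mxM.
move: (U^t*) uU => U' uU; move: (rdiag_mx l) (rdiag_mx m) => D E.
by rewrite !mulmxA -(mulmxA _ U) uU mulmx1.
Qed.

Lemma decmx_const n (U : 'M[C]_n) (c : R) : U \is unitarymx ->
  decmx U (fun=> c) = c%:C%:M.
Proof.
move=> uU; rewrite decmx.unlock.
have -> : rdiag_mx (fun _ : 'I_n => c) = c%:C%:M by apply/matrixP => i j;
  rewrite !mxE.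
by rewrite mul_mx_scalar -scalemxAl unitarymxK// scalemx1.
Qed.

Lemma decmx1 n (U : 'M[C]_n) : U \is unitarymx -> decmx U (fun=> 1) = 1%:M.
Proof. by move=> uU; rewrite decmx_const. Qed.

Lemma spectral_decmx n (X : 'M[C]_n) : X^t* = X ->
  X = decmx (spectralmx X) (fun i => complex.Re (spectral_diag X 0 i)).
Proof.
move=> /hermsymmxP hX.
have /orthomx_spectralP {1}-> := hermitian_normalmx hX.
rewrite invmx_unitary ?spectral_unitarymx// decmx.unlock.
suff -> : rdiag_mx (fun i => complex.Re (spectral_diag X 0 i)) =
  diag_mx (spectral_diag X) by [].
congr diag_mx; apply/rowP => i; rewrite mxE RRe_real//.
by have /mxOverP := hermitian_spectral_diag_real hX.
Qed.

Lemma herm_decmx n (X : 'M[C]_n) : X^t* = X ->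
  exists U l, U \is unitarymx /\ X = decmx U l.
Proof.
move=> /spectral_decmx eX.
exists (spectralmx X), (fun i => complex.Re (spectral_diag X 0 i)).
by split; [exact: spectral_unitarymx|exact: eX].
Qed.

Lemma decmx_form n (U : 'M[C]_n) l (v : 'rV[C]_n) :
  (v *m decmx U l *m v^t*) 0 0 = \sum_i (l i)%:C * `|(v *m U^t*) 0 i| ^+ 2.
Proof.
rewrite decmx.unlock.
have -> : v *m (U^t* *m rdiag_mx l *m U) *m v^t* =
    v *m U^t* *m rdiag_mx l *m (v *m U^t*)^t*.
  by rewrite adjmxM trmxCK !mulmxA.
move: (v *m U^t*) => w; rewrite mxE; apply: eq_bigr => i _.
by rewrite /rdiag_mx mul_mx_diag !mxE normCK mulrA [_ * w 0 i]mulrC.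
Qed.

Lemma psdmx_decmx n (U : 'M[C]_n) l : (forall i, 0 <= l i) -> psdmx (decmx U l).
Proof.
move=> l0; split=> [|v]; first exact: decmx_adj.
by rewrite decmx_form sumr_ge0// => i _; rewrite mulr_ge0 ?exprn_ge0// ler0c.
Qed.

Lemma row_unitary_decmx n (U : 'M[C]_n) l i : U \is unitarymx ->
  row i U *m decmx U l = (l i)%:C *: row i U.
Proof.
move=> /unitarymxP uU; rewrite decmx.unlock !mulmxA -row_mul uU row1.
by rewrite -rowE row_diag_mx -scalemxAl -rowE mxE.
Qed.

Lemma row_unitary_norm n (U : 'M[C]_n) i : U \is unitarymx ->
  (row i U *m (row i U)^t*) 0 0 = 1.
Proof.
move=> /unitarymxP uU; have /matrixP/(_ i i) := uU.
rewrite [X in _ = X]mxE eqxx mulr1n => <-.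
by rewrite !mxE; apply: eq_bigr => j _; rewrite !mxE.
Qed.

Lemma psd_decmx_ge0 n (U : 'M[C]_n) l : U \is unitarymx ->
  psdmx (decmx U l) -> forall i, 0 <= l i.
Proof.
move=> uU [_ pX] i; have := pX (row i U).
by rewrite row_unitary_decmx// -scalemxAl mxE row_unitary_norm// mulr1 ler0c.
Qed.

Lemma psd_decmx n (X : 'M[C]_n) : psdmx X ->
  exists U l, [/\ U \is unitarymx, forall i, 0 <= l i & X = decmx U l].
Proof.
move=> pX; have [U [l [uU eX]]] := herm_decmx (psd_herm pX).
by exists U, l; split=> //; apply: psd_decmx_ge0 uU _; rewrite -eX.
Qed.

Lemma psd_sqrt n (X : 'M[C]_n) : psdmx X ->
  exists a, psdmx a /\ X = a *m a.
Proof.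
move=> /psd_decmx[U [l [uU l0 ->]]]; exists (decmx U (fun i => Num.sqrt (l i))).
split; first by apply: psdmx_decmx => i; rewrite sqrtr_ge0.
by rewrite decmxM//; apply: eq_decmx => i; rewrite -expr2 sqr_sqrtr.
Qed.

(** With [Y = a *m a], cyclicity turns the trace into that of [a *m X *m a], which is again positive
    semidefinite. *)
Lemma psdmx_trM_ge0 n (X Y : 'M[C]_n) : psdmx X -> psdmx Y -> 0 <= \tr (X *m Y).
Proof.
move=> pX /psd_sqrt[a [pa ->]]; rewrite mulmxA mxtrace_mulC mulmxA.
have := psdmx_conj a pX; rewrite (psd_herm pa) => /psdmx_trace_ge0; exact.
Qed.

Lemma funcalc_spectral n (f : R -> R) (X : 'M[C]_n) :
  funcalc f X = decmx (spectralmx X) (fun i =>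
    f (complex.Re (spectral_diag X 0 i))).
Proof.
rewrite /funcalc invmx_unitary ?spectral_unitarymx// decmx.unlock.
suff -> : rdiag_mx (fun i => f (complex.Re (spectral_diag X 0 i))) =
  diag_mx (map_mx (fun z => (f (complex.Re z))%:C) (spectral_diag X)) by [].
by congr diag_mx; apply/rowP => i; rewrite !mxE.
Qed.

(** Turns the equality of two diagonalizations into a condition on the transition matrix [W *m U']
    that can be read entry by entry. *)
Lemma mulmx_intertwine n (U U' W W' D E : 'M[C]_n) :
  U *m U' = 1%:M -> U' *m U = 1%:M -> W *m W' = 1%:M -> W' *m W = 1%:M ->
  W' *m D *m W = U' *m E *m U <-> D *m (W *m U') = (W *m U') *m E.
Proof.
move=> UU' U'U WW' W'W; split=> [DE|DE].
  have := congr1 (fun Z => W *m Z *m U') DE.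
  by rewrite !mulmxA WW' mul1mx -!mulmxA UU' mulmx1.
have := congr1 (fun Z => W' *m Z *m U) DE.
by rewrite !mulmxA W'W mul1mx -!mulmxA U'U mulmx1.
Qed.

(* The entries of a unitary matrix intertwining two diagonalizations vanish
   where the eigenvalues differ. *)
Lemma decmx_inj_fun n (f : R -> R) (U W : 'M[C]_n) (l m : 'I_n -> R) :
  U \is unitarymx -> W \is unitarymx -> decmx W m = decmx U l ->
  decmx W (fun i => f (m i)) = decmx U (fun i => f (l i)).
Proof.
move=> uU uW; have /unitarymxP uU1 := uU; have /unitarymxP uW1 := uW.
have intertwine (x y : 'I_n -> R) : decmx W x = decmx U y <->
    rdiag_mx x *m (W *m U^t*) = (W *m U^t*) *m rdiag_mx y.
  rewrite decmx.unlock.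
  exact: mulmx_intertwine uU1 (unitarymxK uU) uW1 (unitarymxK uW).
move=> /intertwine eM; apply/intertwine.
move: (W *m U^t*) eM => M /matrixP eM; apply/matrixP => i j; have := eM i j.
rewrite /rdiag_mx !mul_diag_mx !mul_mx_diag !mxE.
have [->|M0] := eqVneq (M i j) 0; first by rewrite !mulr0 !mul0r.
by rewrite mulrC => /(mulfI M0)/complexI->; rewrite mulrC.
Qed.

(** [funcalc] relies on one chosen diagonalization; by [decmx_inj_fun] any other one gives the same
    matrix. *)
Lemma funcalc_decmx n (f : R -> R) (U : 'M[C]_n) l : U \is unitarymx ->
  funcalc f (decmx U l) = decmx U (fun i => f (l i)).
Proof.
move=> uU; rewrite funcalc_spectral.
apply: decmx_inj_fun uU (spectral_unitarymx _) _; apply/esym.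
exact: spectral_decmx (decmx_adj U l).
Qed.

End Spectral.

(** * The excess and its variational formula *)

Section Excess.
Variable R : realType.
Notation C := R[i].

Lemma mxtrace_decmx n (U : 'M[C]_n) (l : 'I_n -> R) : U \is unitarymx ->
  \tr (decmx U l) = (\sum_i l i)%:C.
Proof.
move=> /unitarymxP uU; rewrite !decmx.unlock mxtrace_mulC mulmxA uU mul1mx
  mxtrace_diag.
by rewrite rmorph_sum; apply: eq_bigr => i _; rewrite mxE.
Qed.

Lemma mxtrace_mul_decmx n (D U : 'M[C]_n) (l : 'I_n -> R) :
  \tr (D *m decmx U l) = \sum_i (U *m D *m U^t*) i i * (l i)%:C.
Proof.
rewrite !decmx.unlock !mulmxA mxtrace_mulC !mulmxA.
by apply: eq_bigr => i _; rewrite mul_mx_diag !mxE.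
Qed.

Definition excess n (s : R) (X : 'M[C]_n) : R :=
  \sum_i Num.max (complex.Re (spectral_diag X 0 i) - s) 0.

Lemma excess_decmx n s (U : 'M[C]_n) l : U \is unitarymx ->
  excess s (decmx U l) = \sum_i Num.max (l i - s) 0.
Proof.
move=> uU; apply: complexI.
rewrite -(mxtrace_decmx (fun i => Num.max (l i - s) 0) uU).
rewrite -(mxtrace_decmx _ (spectral_unitarymx (decmx U l))).
rewrite -(funcalc_spectral (fun t => Num.max (t - s) 0)).
by rewrite (funcalc_decmx (fun t => Num.max (t - s) 0) _ uU).
Qed.

(** The constraint set of the variational formula for [excess]. *)
Definition effectmx n (D : 'M[C]_n) : Prop := psdmx D /\ psdmx (1%:M - D).

Lemma effect_decmx n (U : 'M[C]_n) (l : 'I_n -> R) : U \is unitarymx ->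
  (forall i, 0 <= l i <= 1) -> effectmx (decmx U l).
Proof.
move=> uU l01; split; first by apply: psdmx_decmx => i; case/andP: (l01 i).
rewrite -(decmx1 uU) decmxB; apply: psdmx_decmx => i.
by rewrite subr_ge0; case/andP: (l01 i).
Qed.

(** In an eigenbasis of [X] only the diagonal entries [d] of [D] enter; they lie between 0 and 1, so
    each term [d * (l i - s)] is at most the positive part of [l i - s]. *)
Lemma le_excess n s (D X : 'M[C]_n) : X^t* = X -> effectmx D ->
  \tr (D *m X) - s%:C * \tr D <= (excess s X)%:C.
Proof.
move=> /herm_decmx[U [l [uU ->]]] [pD qD].
rewrite excess_decmx// mxtrace_mul_decmx.
have -> : \tr D = \tr (U *m D *m U^t*).
  by rewrite mxtrace_mulC mulmxA unitarymxK// mul1mx.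
have uU' : U *m U^t* = 1%:M by apply/unitarymxP.
have /psdmx_diag d0 : psdmx (U *m D *m U^t*).
  by have := psdmx_conj (U^t*) pD; rewrite trmxCK.
have /psdmx_diag d1 : psdmx (1%:M - U *m D *m U^t*).
  have := psdmx_conj (U^t*) qD; rewrite trmxCK.
  by rewrite mulmxBr mulmx1 mulmxBl uU'.
rewrite /mxtrace mulr_sumr -sumrB rmorph_sum; apply: ler_sum => i _.
set d := U *m D *m U^t* in d0 d1 *.
have {d1} : d i i <= 1 by have := d1 i; rewrite !mxE eqxx mulr1n subr_ge0.
have {d0} := d0 i; move: (d i i) => {}d d0 d1.
rewrite [s%:C * d]mulrC -mulrBr -rmorphB.
have [ls|ls] := leP 0 (l i - s).
  by rewrite ler_piMl// ler0c.
by rewrite rmorph0 mulr_ge0_le0// -[0](rmorph0 (real_complex R)) lecR ltW.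
Qed.

(** The maximizer is the spectral projection for the eigenvalues above [s]. *)
Lemma excess_attained n (s : R) (U : 'M[C]_n) (l : 'I_n ->
  R) : U \is unitarymx ->
  let D := decmx U (fun i => (s < l i)%R%:R) in
  effectmx D /\ (excess s (decmx U l))%:C = \tr (D *m decmx U l) - s%:C * \tr D.
Proof.
move=> uU D; split; first by apply: effect_decmx => // i; case: ltP;
  rewrite ?lexx ler01.
rewrite excess_decmx// decmxM// !mxtrace_decmx// -rmorphM -rmorphB; congr _%:C.
rewrite mulr_sumr -sumrB; apply: eq_bigr => i _.
case: ltP => [ls|ls] /=; first by rewrite mul1r mulr1 max_l// subr_ge0 ltW.
by rewrite mul0r mulr0 subr0 max_r// subr_le0.
Qed.

Lemma excess_ge0 n s (X : 'M[C]_n) : 0 <= excess s X.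
Proof. by apply: sumr_ge0 => i _; rewrite le_max lexx orbT. Qed.


End Excess.

(** Writing L' for the adjoint of L, one has 1 - L L' = (1 - L L')^2 + L (1 - L' L) L', a sum of
    positive semidefinite terms. *)
Lemma psdmx_contraction_adj (C : numClosedFieldType) m n (L : 'M[C]_(m, n)) :
  psdmx (1%:M - L^t* *m L) -> psdmx (1%:M - L *m L^t*).
Proof.
move=> pL.
have -> : 1%:M - L *m L^t* =
    (1%:M - L *m L^t*)^t* *m (1%:M - L *m L^t*) +
    (L^t*)^t* *m (1%:M - L^t* *m L) *m L^t*.
  rewrite trmxCK adjmxB adjmx1 adjmxM trmxCK.
  rewrite !(mulmxBl, mulmxBr) !mul1mx !mulmx1 !mulmxA.
  by rewrite subrK.
by apply: psdmxD; [exact: psdmx_gram | exact: psdmx_conj].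
Qed.

Lemma gram_eq0 (C : numClosedFieldType) m n (A : 'M[C]_(m, n)) :
  A^t* *m A = 0 -> A = 0.
Proof.
move=> A0; apply/matrixP => i j; have /matrixP/(_ j j) := A0.
rewrite !mxE => /eqP; rewrite psumr_eq0; last first.
  by move=> k _; rewrite !mxE mulrC mul_conjC_ge0.
by move=> /allP/(_ i (mem_index_enum _));
  rewrite !mxE mulrC mul_conjC_eq0 => /eqP.
Qed.

(** * Superadditivity of the excess, and its value on block diagonal matrices *)

Section Superadditivity.
Variable R : realType.
Notation C := R[i].

Lemma psdmx_addr_eq0 n (X Y : 'M[C]_n) :
  psdmx X -> psdmx Y -> X + Y = 0 -> X = 0.
Proof.
move=> /psd_sqrt[a [pa ->]] [_ pY] XY0; suff -> : a = 0 by rewrite mulmx0.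
rewrite -(trmxCK a) (psd_herm pa).
have ha := psd_herm pa.
suff va0 : forall v : 'rV[C]_n, v *m a = 0.
  by rewrite ha; apply/row_matrixP => i; rewrite row0 rowE va0.
move=> v; apply/eqP; rewrite -[_ == _]negbK; apply/negP => va0.
have : (v *m (a *m a + Y) *m v^t*) 0 0 = 0 by rewrite XY0 mulmx0 mul0mx mxE.
rewrite mulmxDr mulmxDl mxE => /eqP.
have -> : v *m (a *m a) *m v^t* = (v *m a) *m (v *m a)^t*.
  by rewrite adjmxM ha !mulmxA.
rewrite -dotmxE gt_eqF// ltr_pwDl//.
exact: dotmx_is_dotmx.
Qed.

(* With [Z = X + Y], [a = X^(1/2)] and [b = Y^(1/2)], one has
   [a = V *m Z^(1/2)] and [b = W *m Z^(1/2)] where [V^t* V + W^t* W] is a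
   projection; [V] and [W] transport effects for [X] and [Y] to one for [Z].
   Since [0^-1 = 0], [Qi] below is the pseudo-inverse of [Z^(1/2)]. *)
Lemma excess_superadd n s (X Y : 'M[C]_n) : 0 <= s -> psdmx X -> psdmx Y ->
  excess s X + excess s Y <= excess s (X + Y).
Proof.
move=> s0 pX pY.
have [a [pa eX]] := psd_sqrt pX; have [b [pb eY]] := psd_sqrt pY.
have [U [l [uU l0 eZ]]] := psd_decmx (psdmxD pX pY).
set Z := X + Y in eZ *.
pose r i := Num.sqrt (l i).
pose Q := decmx U r; pose Qi := decmx U (fun i => (r i)^-1).
(* The projection onto the kernel of [Z]: its eigenvalue is 1 where [r i = 0], and 0 elsewhere. *)
pose N := decmx U (fun i => 1 - (r i)^-1 * r i).
have eN : N = 1%:M - Qi *m Q by rewrite decmxM// -(decmx1 uU) decmxB.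
have hN : N^t* = N by exact: decmx_adj.
have hQi : Qi^t* = Qi by exact: decmx_adj.
have hQ : Q^t* = Q by exact: decmx_adj.
have rr i : r i * r i = l i by rewrite -expr2 sqr_sqrtr.
have QQ : Q *m Q = Z by rewrite eZ decmxM//; apply: eq_decmx.
have NZN : N *m X *m N + N *m Y *m N = 0.
  rewrite -mulmxDl -mulmxDr -/Z eZ !decmxM//.
  suff /eq_decmx-> : (fun i =>
    (1 - (r i)^-1 * r i) * l i * (1 - (r i)^-1 * r i)) =1 (fun=> 0).
    by rewrite decmx_const//; apply/matrixP => i j; rewrite !mxE mul0rn.
  move=> i; have [r0|r0] := eqVneq (r i) 0.
    by rewrite -rr r0 !(mulr0, mul0r).
  by rewrite mulVf// subrr mulr0.
(* Here [c *m N = 0], that is, [c] vanishes on the kernel of [Z], so dividing by [Q] and multiplying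
   back recovers [c]. *)
have KN (c W : 'M[C]_n) : psdmx c -> W = c *m c -> N *m W *m N = 0 ->
  c *m Qi *m Q = c.
  move=> pc -> cN; have /gram_eq0 : (c *m N)^t* *m (c *m N) = 0.
    by rewrite adjmxM hN (psd_herm pc) mulmxA -(mulmxA N).
  rewrite eN mulmxBr mulmx1 mulmxA => /eqP; rewrite subr_eq0 => /eqP/esym.
  by [].
have pNXN : psdmx (N *m X *m N) by rewrite -{1}hN; exact: psdmx_conj.
have pNYN : psdmx (N *m Y *m N) by rewrite -{1}hN; exact: psdmx_conj.
have aQ : a *m Qi *m Q = a by apply: KN eX _ => //; exact: psdmx_addr_eq0 NZN.
have bQ : b *m Qi *m Q = b.
  by apply: KN eY _ => //; apply: psdmx_addr_eq0 pNYN pNXN _; rewrite addrC.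
pose V := a *m Qi; pose W := b *m Qi.
have VW : V^t* *m V + W^t* *m W = decmx U (fun i => (r i)^-1 * l i * (r i)^-1).
  rewrite !adjmxM !hQi (psd_herm pa) (psd_herm pb) !mulmxA.
  rewrite -(mulmxA Qi a) -(mulmxA Qi b) -eX -eY -mulmxDl -mulmxDr -/Z eZ.
  by rewrite !decmxM.
have VQ : V *m Q = a by [].
have WQ : W *m Q = b by [].
clearbody V W.
have pVW : psdmx (1%:M - (V^t* *m V + W^t* *m W)).
  rewrite VW -(decmx1 uU) decmxB; apply: psdmx_decmx => i.
  have [r0|r0] := eqVneq (r i) 0; first by rewrite r0 invr0 mulr0 subr0.
  by rewrite -rr mulrA mulVf// mul1r divff// subrr.
have subDK (P S : 'M[C]_n) : 1%:M - P = 1%:M - (P + S) + S.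
  by rewrite opprD addrA subrK.
have cV : psdmx (1%:M - V *m V^t*).
  apply: psdmx_contraction_adj; rewrite (subDK _ (W^t* *m W)).
  by apply: psdmxD pVW _; exact: psdmx_gram.
have cW : psdmx (1%:M - W *m W^t*).
  apply: psdmx_contraction_adj; rewrite (subDK _ (V^t* *m V)).
  rewrite (addrC (W^t* *m W)).
  by apply: psdmxD pVW _; exact: psdmx_gram.
have [U1 [l1 [uU1 _ eX1]]] := psd_decmx pX.
have [U2 [l2 [uU2 _ eY1]]] := psd_decmx pY.
have [] := excess_attained s l1 uU1; rewrite -eX1.
set D := decmx U1 _ => -[pD qD] xX.
have [] := excess_attained s l2 uU2; rewrite -eY1.
set E := decmx U2 _ => -[pE qE] xY.
have -> : (excess s X + excess s Y <= excess s Z) =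
  ((excess s X)%:C + (excess s Y)%:C <=
    (excess s Z)%:C) by rewrite -rmorphD lecR.
rewrite xX xY.
pose F := V^t* *m D *m V + W^t* *m E *m W.
have eF : effectmx F.
  split; first by apply: psdmxD; exact: psdmx_conj.
  have addBK (P S P' S' : 'M[C]_n) :
      1%:M - (P' + S') = 1%:M - (P + S) + (P - P' + (S - S')).
    by rewrite (addrACA P) -opprD addrA subrK.
  rewrite /F (addBK (V^t* *m V) (W^t* *m W)).
  have conjB (G c : 'M[C]_n) : c^t* *m c - c^t* *m G *m c =
    c^t* *m (1%:M - G) *m c.
    by rewrite mulmxBr mulmxBl mulmx1.
  rewrite !conjB; apply: psdmxD pVW _.
  by apply: psdmxD; exact: psdmx_conj.
apply: le_trans (le_excess s (psd_herm (psdmxD pX pY)) eF).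
have tra (G c v : 'M[C]_n) : psdmx c -> v *m Q = c ->
    \tr (v^t* *m G *m v *m Z) = \tr (G *m (c *m c)).
  move=> pc vc; rewrite -QQ !mulmxA mxtrace_mulC !mulmxA.
  rewrite -(mulmxA _ v) vc.
  rewrite -{1}hQ -adjmxM vc (psd_herm pc).
  by rewrite -!mulmxA [LHS]mxtrace_mulC -mulmxA.
have -> : \tr (F *m (X + Y)) = \tr (D *m X) + \tr (E *m Y).
  by rewrite mulmxDl mxtraceD (tra _ a)// (tra _ b)// -eX -eY.
(* By cyclicity [D] is tested against [V *m V^t*] and [E] against [W *m W^t*], both at most 1. As
   [0 <= s], the penalty [s * \tr F] does not exceed the two given ones. *)
have trD : \tr F <= \tr D + \tr E.
  rewrite mxtraceD -subr_ge0 opprD addrACA addr_ge0//.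
    have := psdmx_trM_ge0 pD cV.
    by rewrite mulmxBr mulmx1 linearB/= mulmxA mxtrace_mulC mulmxA.
  have := psdmx_trM_ge0 pE cW.
  by rewrite mulmxBr mulmx1 linearB/= mulmxA mxtrace_mulC mulmxA.
by rewrite addrACA -opprD -mulrDr lerD2l lerN2 ler_wpM2l// ler0c.
Qed.


Lemma decmx_block m n (U : 'M[C]_m) (V : 'M[C]_n) l k :
  block_mx (decmx U l) 0 0 (decmx V k) =
  decmx (block_mx U 0 0 V)
    (fun i => match fintype.split i with inl j => l j | inr j => k j end).
Proof.
rewrite !decmx.unlock adjmx_block.
have -> : rdiag_mx (fun i => match fintype.split i with
    inl j => l j | inr j => k j end) = block_mx (rdiag_mx l) 0 0 (rdiag_mx k).
  rewrite /rdiag_mx -diag_mx_row; congr diag_mx.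
  by apply/rowP => i; rewrite !mxE; case: fintype.split => j; rewrite mxE.
rewrite !trmx0 !map_mx0 !mulmx_block.
by rewrite !(mulmx0, mul0mx, addr0, add0r).
Qed.

Lemma unitarymx_block m n (U : 'M[C]_m) (V : 'M[C]_n) :
  U \is unitarymx -> V \is unitarymx -> block_mx U 0 0 V \is unitarymx.
Proof.
move=> /unitarymxP uU /unitarymxP uV; apply/unitarymxP.
rewrite adjmx_block !trmx0 !map_mx0 mulmx_block.
by rewrite !(mulmx0, mul0mx, addr0, add0r) uU uV -scalar_mx_block.
Qed.

Lemma excess_block m n s (X : 'M[C]_m) (Y : 'M[C]_n) : X^t* = X -> Y^t* = Y ->
  excess s (block_mx X 0 0 Y) = excess s X + excess s Y.
Proof.
move=> /herm_decmx[U [l [uU ->]]] /herm_decmx[V [k [uV ->]]].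
rewrite decmx_block !excess_decmx ?unitarymx_block// big_split_ord/=.
by congr (_ + _); apply: eq_bigr => i _;
  rewrite ?(unsplitK (inl _)) ?(unsplitK (inr _)).
Qed.

Lemma excess0 n s : 0 <= s -> excess s (0 : 'M[C]_n) = 0.
Proof.
move=> s0; have u1 : (1%:M : 'M[C]_n) \is unitarymx.
  by apply/unitarymxP; rewrite adjmx1 mulmx1.
have -> : 0 = decmx (1%:M : 'M[C]_n) (fun=> 0).
  by rewrite decmx_const//; apply/matrixP => i j; rewrite !mxE mul0rn.
by rewrite excess_decmx// big1// => i _; rewrite max_r// sub0r oppr_le0.
Qed.

(** Padding only adds eigenvalues 0, which contribute nothing at a level [s >= 0]. *)
Lemma excess_padmx n s (X : 'M[C]_n) : 0 <= s -> X^t* = X ->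
  excess s (padmx X) = excess s X.
Proof.
by move=> s0 hX; rewrite excess_block ?excess0 ?addr0// trmx0 map_mx0.
Qed.

End Superadditivity.

(** * Passage from dyadic to real exponents *)

Section DyadicLimit.
Import numFieldNormedType.Exports.
Local Open Scope classical_set_scope.
Local Open Scope ring_scope.
Variable R : realType.

(** The truncations of [q] to [n] binary digits converge to [q], and nonnegativity passes to the
    limit. *)
Lemma dyadic_ge0 (F : R -> R) : continuous F ->
  (forall n k, (k <= 2 ^ n)%N -> 0 <= F (k%:R / (2 ^ n)%:R)) ->
  forall q : R, 0 <= q <= 1 -> 0 <= F q.
Proof.
move=> cF F0 q /andP[q0 q1].
pose k n := Num.truncn (q * (2 ^ n)%:R).
have p0 n : 0 < (2 ^ n)%:R :> R by rewrite ltr0n expn_gt0.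
pose u n : R := (k n)%:R / (2 ^ n)%:R.
have kle n : (k n)%:R <= q * (2 ^ n)%:R by rewrite truncn_le mulr_ge0.
have klt n : q * (2 ^ n)%:R < (k n).+1%:R by exact: truncnS_gt.
have uq : u n @[n --> \oo] --> q.
  apply: (squeeze_cvgr (f := fun n => q - (2^-1) ^+ n) (h := fun=> q)).
  - apply: nearW => n; rewrite /u ler_pdivrMr// kle andbT.
    rewrite ler_pdivlMr// exprVn -natrX mulrBl mulVf ?gt_eqF// lerBlDr.
    by rewrite natr1 ltW.
  - have h1 : `|2^-1 : R| < 1 by rewrite ger0_norm// invf_lt1 ?ltr1n.
    have := cvgB (@cvg_cst R q nat \oo _) (cvg_expr h1).
    by rewrite subr0; apply.
  - exact: cvg_cst.
have Fuq : F (u n) @[n --> \oo] --> F q by apply: continuous_cvg => //;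
  exact: cF.
rewrite -(cvg_lim _ Fuq)//; apply: limr_ge; first exact: cvgP Fuq.
apply: nearW => n; apply: F0.
by rewrite -(ler_nat R) (le_trans (kle n))// ler_piMl.
Qed.

Lemma continuous_sum_powR n (a c : 'I_n -> R) : (forall i, 0 < a i) ->
  continuous (fun q : R => \sum_i a i `^ (- q) * c i).
Proof.
move=> a0.
have -> : (fun q : R => \sum_i a i `^ (- q) * c i) =
    \sum_i (fun q : R => expR (- q * ln (a i)) * c i).
  apply/funext => q; rewrite fct_sumE; apply: eq_bigr => i _.
  by rewrite /powR gt_eqF.
elim/big_ind: _ => [|f g cf cg|i _] q; first exact: cvg_cst.
  by apply: continuousD; [exact: cf|exact: cg].
apply: cvgM; last exact: cvg_cst.
apply: continuous_comp; last exact: continuous_expR.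
by apply: cvgM; [exact: cvgN|exact: cvg_cst].
Qed.

(** [F] is the shape of the quadratic form of a difference of negative matrix powers at a fixed
    vector, as a function of the exponent. *)
Lemma sum_powR_dyadic_ge0 n (a b c d : 'I_n -> R) (q : R) :
  (forall i, 0 < a i) -> (forall i, 0 < b i) ->
  let F t := \sum_i a i `^ (- t) * c i - \sum_i b i `^ (- t) * d i in
  (forall m k, (k <= 2 ^ m)%N -> 0 <= F (k%:R / (2 ^ m)%:R)) ->
  0 <= q <= 1 -> 0 <= F q.
Proof.
move=> a0 b0 F F0; apply: dyadic_ge0 F0 q.
by move=> t; apply: cvgB; exact: continuous_sum_powR.
Qed.

End DyadicLimit.

(** * The Loewner-Heinz inequality for exponents between -1 and 0 *)

Section LoewnerHeinz.
Variable R : realType.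
Notation C := R[i].

Lemma decmx_powRM n (U : 'M[C]_n) (a : 'I_n -> R) s t : U \is unitarymx ->
  (forall i, 0 < a i) ->
  decmx U (fun i => a i `^ s) *m decmx U (fun i => a i `^ t) =
  decmx U (fun i => a i `^ (s + t)).
Proof.
move=> uU a0; rewrite decmxM//; apply: eq_decmx => i.
by rewrite powRD//; apply/implyP => _; rewrite gt_eqF.
Qed.

(** Neither factor lengthens a row vector, so [c ^+ 2] times the squared length of [w] is at most
    that squared length. *)
Lemma contraction_eigenvalue_le1 n (K L : 'M[C]_n) (w : 'rV[C]_n) (c : R) :
  psdmx (1%:M - K *m K^t*) -> psdmx (1%:M - L *m L^t*) ->
  w != 0 -> w *m K *m L = c%:C *: w -> c <= 1.
Proof.
move=> cK cL /dotmx_is_dotmx; rewrite dotmxE => w0 wKL.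
have cle (M : 'M[C]_n) (z : 'rV[C]_n) : psdmx (1%:M - M *m M^t*) ->
    ((z *m M) *m (z *m M)^t*) 0 0 <= (z *m z^t*) 0 0.
  move=> [_ /(_ z)]; rewrite mulmxBr mulmxBl mulmx1 mxE [X in _ + X]mxE
    subr_ge0.
  by rewrite adjmxM !mulmxA.
have : (c%:C ^+ 2) * (w *m w^t*) 0 0 <= (w *m w^t*) 0 0.
  have -> : c%:C ^+ 2 * (w *m w^t*) 0 0 =
      ((w *m K *m L) *m (w *m K *m L)^t*) 0 0.
    rewrite wKL linearZ/= map_mxZ -scalemxAl -scalemxAr scalerA [RHS]mxE.
    by rewrite /= conj_real_complex expr2.
  exact: le_trans (cle _ (w *m K) cL) (cle _ w cK).
rewrite -[leRHS]mul1r ler_pM2r// -rmorphXn -(rmorph1 (real_complex R)) lecR.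
move=> c1; rewrite leNgt; apply/negP => c2.
by move: c1; rewrite leNgt exprn_egt1.
Qed.

(** The squared modulus, with values in [R] rather than in [C]. *)
Definition normc2 (z : C) : R := complex.Re z ^+ 2 + complex.Im z ^+ 2.

Lemma normc2E (z : C) : (normc2 z)%:C = `|z| ^+ 2.
Proof. by rewrite add_Re2_Im2. Qed.

Lemma decmx_formR n (U : 'M[C]_n) (l : 'I_n -> R) (v : 'rV[C]_n) :
  (v *m decmx U l *m v^t*) 0 0 =
  (\sum_i l i * normc2 ((v *m U^t*) 0 i))%:C.
Proof.
rewrite decmx_form rmorph_sum; apply: eq_bigr => i _.
by rewrite rmorphM -normc2E.
Qed.

Section OneParameterGroups.
Variables (n : nat) (A B : R -> 'M[C]_n).
Hypotheses (AM : forall s t, A s *m A t = A (s + t)).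
Hypotheses (BM : forall s t, B s *m B t = B (s + t)).
Hypotheses (A0 : A 0 = 1%:M) (B0 : B 0 = 1%:M).
Hypotheses (hA : forall t, (A t)^t* = A t) (hB : forall t, (B t)^t* = B t).
Hypothesis leAB : psdmx (B 1 - A 1).

(** The inequality [A q <= B q] in the Loewner order, expressed by saying that [L q] below is a
    contraction. *)
Definition powcontr q := psdmx (1%:M - B (- (q / 2)) *m A q *m B (- (q / 2))).

Let L q := A (q / 2) *m B (- (q / 2)).

Let LL q : (L q)^t* *m L q = B (- (q / 2)) *m A q *m B (- (q / 2)).
Proof.
rewrite /L adjmxM hA hB !mulmxA; congr (_ *m _).
by rewrite -mulmxA AM -splitr.
Qed.

Lemma powcontr0 : powcontr 0.
Proof.
rewrite /powcontr mul0r oppr0 A0 B0 !mulmx1 subrr; exact: psdmx0.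
Qed.

Lemma powcontr1 : powcontr 1.
Proof.
rewrite /powcontr; have := psdmx_conj (B (- (1 / 2))) leAB; rewrite hB.
rewrite mulmxBr mulmxBl.
by rewrite !BM [X in B X](_ : _ = 0) ?B0//; field.
Qed.

(** For [r = (p + q) / 2], the matrix [(L r)^t* *m L r] is similar, through [B ((p - q) / 4)], to
    [(L p)^t* *m L q]. The latter is a product of two contractions, so its real eigenvalues are at
    most 1. *)
Lemma powcontr_mid p q : powcontr p -> powcontr q -> powcontr ((p + q) / 2).
Proof.
move=> cp cq; set r := (p + q) / 2; rewrite /powcontr -LL.
have [W [m [uW eM]]] : exists W m, W \is unitarymx /\ (L r)^t* *m L r =
  decmx W m.
  by apply: herm_decmx; rewrite adjmxM trmxCK.
rewrite eM -(decmx1 uW) decmxB; apply: psdmx_decmx => i; rewrite subr_ge0.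
pose v := row i W; pose w := v *m B ((p - q) / 4).
have vM : v *m (B (- (r / 2)) *m A r *m B (- (r / 2))) = (m i)%:C *: v.
  by rewrite -LL eM row_unitary_decmx.
have wK : w *m (L p)^t* *m L q = (m i)%:C *: w.
  rewrite /w scalemxAl -vM /L adjmxM hA hB -!mulmxA BM.
  rewrite (mulmxA (B _) (B _)) BM (mulmxA (A _) (A _)) AM.
  by congr (_ *m (B _ *m (A _ *m B _))); rewrite /r; field.
apply: (@contraction_eigenvalue_le1 _ ((L p)^t*) (L q) w) wK.
- by rewrite (trmxCK (L p)) LL; exact: cp.
- by apply: (@psdmx_contraction_adj _ _ _ (L q)); rewrite LL; exact: cq.
apply/eqP => w0.
have v0 : v = 0.
  have := congr1 (fun M => M *m B (- ((p - q) / 4))) w0.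
  by rewrite mul0mx /w -mulmxA BM subrr B0 mulmx1.
have := row_unitary_norm i uW; rewrite -/v v0 mul0mx mxE => /esym/eqP.
by rewrite oner_eq0.
Qed.

Lemma powcontr_dyadic k j : (j <= 2 ^ k)%N -> powcontr (j%:R / (2 ^ k)%:R).
Proof.
elim: k j => [|k IH] j.
  case: j => [|[|j]] j1; last by exfalso.
    by rewrite mul0r; exact: powcontr0.
  by rewrite expn0 divr1; exact: powcontr1.
(* Since [j = j./2 + uphalf j], a dyadic of level [k.+1] is the midpoint of two dyadics of level
   [k]. *)
move=> jk; have -> : j%:R / (2 ^ k.+1)%:R =
    ((j./2)%:R / (2 ^ k)%:R + (uphalf j)%:R / (2 ^ k)%:R) / 2 :> R.
  rewrite -mulrDl -natrD.
  have -> : (j./2 + uphalf j =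
    j)%N by rewrite uphalf_half addnCA addnn odd_double_half.
  by rewrite expnS mulnC natrM invfM mulrA.
apply: powcontr_mid; apply: IH.
  by rewrite leq_half_double -mul2n -expnS leqW.
by rewrite leq_uphalf_double -mul2n -expnS.
Qed.

(** The adjoint of [L q] is a contraction too, so [A (q / 2) *m B (- q) *m A (q / 2) <= 1];
    conjugating by [A (- (q / 2))] gives the reversed order for inverses. *)
Lemma powcontr_le q : powcontr q -> psdmx (A (- q) - B (- q)).
Proof.
rewrite /powcontr -LL => /psdmx_contraction_adj cq.
have := psdmx_conj (A (- (q / 2))) cq.
rewrite hA mulmxBr mulmxBl mulmx1 AM -opprD -splitr.
rewrite /L adjmxM hA hB !mulmxA AM addNr A0 mul1mx -!mulmxA AM addrN A0 mulmx1.
by rewrite BM -opprD -splitr.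
Qed.

Lemma dyadic_antimono k j : (j <= 2 ^ k)%N ->
  psdmx (A (- (j%:R / (2 ^ k)%:R)) - B (- (j%:R / (2 ^ k)%:R))).
Proof. by move=> jk; exact/powcontr_le/powcontr_dyadic. Qed.

End OneParameterGroups.

(** The midpoint argument settles dyadic exponents; at each fixed vector the quadratic form is
    continuous in the exponent. *)
Lemma loewner_heinz_neg n (U V : 'M[C]_n) (a b : 'I_n -> R) q :
  U \is unitarymx -> V \is unitarymx ->
  (forall i, 0 < a i) -> (forall i, 0 < b i) ->
  psdmx (decmx V b - decmx U a) -> 0 <= q <= 1 ->
  psdmx (decmx U (fun i => a i `^ (- q)) - decmx V (fun i => b i `^ (- q))).
Proof.
move=> uU uV a0 b0 leAB q01; split; first by rewrite adjmxB !decmx_adj.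
move=> v.
pose F t := \sum_i a i `^ (- t) * normc2 ((v *m U^t*) 0 i) -
            \sum_i b i `^ (- t) * normc2 ((v *m V^t*) 0 i).
have vF t : (v *m (decmx U (fun i => a i `^ (- t)) -
    decmx V (fun i => b i `^ (- t))) *m v^t*) 0 0 = (F t)%:C.
  by rewrite mulmxBr mulmxBl [LHS]mxE [X in _ + X]mxE !decmx_formR -rmorphB.
rewrite vF ler0c; apply: (sum_powR_dyadic_ge0 a0 b0 _ q01) => k j jk;
  rewrite -/F.
rewrite -ler0c -vF.
have pow0 W (c : 'I_n -> R) : W \is unitarymx ->
    decmx W (fun i => c i `^ 0) = 1%:M.
  by move=> uW; rewrite -(decmx1 uW); apply: eq_decmx => i; rewrite powRr0.
have pow1 W (c : 'I_n -> R) : (forall i, 0 < c i) ->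
    decmx W (fun i => c i `^ 1) = decmx W c.
  by move=> c0; apply: eq_decmx => i; rewrite powRr1// ltW.
have [|||||||_] := @dyadic_antimono n (fun t => decmx U (fun i => a i `^ t))
  (fun t => decmx V (fun i => b i `^ t)) _ _ _ _ _ _ _ k j jk; last exact.
- by move=> s t; exact: decmx_powRM.
- by move=> s t; exact: decmx_powRM.
- exact: (pow0 U a uU).
- exact: (pow0 V b uV).
- by move=> t; exact: decmx_adj.
- by move=> t; exact: decmx_adj.
- by rewrite !pow1.
Qed.

End LoewnerHeinz.

(** * The Ando-Zhan inequality for powers *)

Section Subadditivity.
Variable R : realType.
Notation C := R[i].

Lemma ler_powR_ge0 (r x y : R) : 0 <= r -> 0 <= x -> x <= y -> x `^ r <= y `^ r.
Proof.
move=> r0 x0 xy; apply: ge0_ler_powR => //; rewrite nnegrE//.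
exact: le_trans xy.
Qed.

Lemma lef_powR_le0 (r x y : R) : r <= 0 -> 0 < x -> x <= y -> y `^ r <= x `^ r.
Proof.
move=> r0 x0 xy; have y0 := lt_le_trans x0 xy.
rewrite -[r]opprK (powRN x (- r)) (powRN y (- r)) lef_pV2 ?posrE ?powR_gt0//.
by rewrite ler_powR_ge0 ?oppr_ge0// ltW.
Qed.

(** The shift keeps the exponent [p - 1 <= 0] away from the base 0, and it lowers the value since
    such a power is nonincreasing. *)
Lemma powR_shift_le (p x eps : R) : 0 < p <= 1 -> 0 <= x -> 0 < eps ->
  x * (x + eps) `^ (p - 1) <= x `^ p.
Proof.
move=> /andP[p0 p1]; rewrite le_eqVlt => /predU1P[<-|x0] e0.
  by rewrite mul0r powR_ge0.
rewrite -(mulr_powRB1 (ltW x0) p0); apply: ler_wpM2l; first exact: ltW.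
by rewrite lef_powR_le0 ?subr_le0// lerDl ltW.
Qed.

(** Split (x + eps)^p as (x + eps) (x + eps)^(p-1); the part with factor eps is at most eps
    eps^(p-1) = eps^p. *)
Lemma powR_shift_ge (p x eps : R) : 0 < p <= 1 -> 0 <= x -> 0 < eps ->
  x `^ p <= x * (x + eps) `^ (p - 1) + eps `^ p.
Proof.
move=> /andP[p0 p1] x0 e0; have xe0 : 0 < x + eps by rewrite ltr_wpDl.
apply: (@le_trans _ _ ((x + eps) `^ p)).
  by rewrite ler_powR_ge0 ?lerDl// ltW.
rewrite -(mulr_powRB1 (ltW xe0) p0) mulrDl lerD2l -(mulr_powRB1 (ltW e0) p0).
apply: ler_wpM2l; first exact: ltW.
by rewrite lef_powR_le0 ?subr_le0// lerDr.
Qed.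

(** Twice the difference of the two sides, symmetrized in [i] and [j], has the terms
    [(e i - e j) * (g j - g i) * w i j]. *)
Lemma chebyshev_sum n (e g : 'I_n -> R) (w : 'I_n -> 'I_n -> R) :
  (forall i j, 0 <= w i j) -> (forall i j, w i j = w j i) ->
  (forall i j, 0 <= (e i - e j) * (g j - g i)) ->
  \sum_i \sum_j e i * g i * w i j <= \sum_i \sum_j e i * g j * w i j.
Proof.
move=> w0 wC eg; rewrite -subr_ge0 -sumrB.
set D := \sum_(i < n) _; suff : 0 <= D + D by rewrite -mulr2n pmulrn_lge0.
have -> : D = \sum_i \sum_j e i * (g j - g i) * w i j.
  apply: eq_bigr => i _; rewrite -sumrB; apply: eq_bigr => j _.
  by rewrite -mulrBl -mulrBr.
rewrite [X in _ + X]exchange_big/= -big_split/=; apply: sumr_ge0 => i _.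
rewrite -big_split/=; apply: sumr_ge0 => j _.
rewrite [X in _ + X](_ : _ = - e j * (g j - g i) * w i j).
  by rewrite -mulrDl -mulrDl mulr_ge0.
by rewrite (wC j i) -[g i - g j]opprB mulrN !mulNr.
Qed.

Lemma normc2_ge0 (z : C) : 0 <= normc2 z.
Proof. by rewrite addr_ge0 ?sqr_ge0. Qed.

Lemma normc2_conj (z : C) : normc2 (Num.conj z) = normc2 z.
Proof. by apply: complexI; rewrite !normc2E norm_conjC. Qed.

Lemma mxtrace_decmx_conj n (U X : 'M[C]_n) (e g : 'I_n -> R) : X^t* = X ->
  \tr (decmx U e *m X *m decmx U g *m X) =
  (\sum_i \sum_j e i * g j * normc2 ((U *m X *m U^t*) i j))%:C.
Proof.
move=> hX.
have cyc (D E : 'M[C]_n) : \tr ((U^t* *m D *m U) *m X *m (U^t* *m E *m U) *m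
  X) =
    \tr (D *m ((U *m X *m U^t*) *m E *m (U *m X *m U^t*))).
  by rewrite -!mulmxA [LHS]mxtrace_mulC -!mulmxA.
have hY : (U *m X *m U^t*)^t* =
  U *m X *m U^t* by rewrite !adjmxM trmxCK hX mulmxA.
rewrite decmx.unlock cyc; move: (U *m X *m U^t*) hY => Y hY.
rewrite mul_diag_mx /mxtrace rmorph_sum; apply: eq_bigr => i _.
rewrite !mxE rmorph_sum mulr_sumr; apply: eq_bigr => j _.
rewrite mul_mx_diag !mxE !rmorphM -!mulrA; congr (_ * _).
rewrite [Y i j * _]mulrC -mulrA; congr (_ * _).
change (Y j i * Y i j = (normc2 (Y i j))%:C).
by rewrite normc2E normCK mulrC; congr (_ * _); rewrite -[in LHS]hY !mxE.
Qed.

(* The Chebyshev sum inequality, weighted by the squared moduli of the entries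
   of [X] in the basis [U]. *)
Lemma mxtrace_antitone_le n (U X : 'M[C]_n) (e g : 'I_n -> R) :
  U \is unitarymx -> X^t* = X ->
  (forall i j, 0 <= (e i - e j) * (g j - g i)) ->
  \tr (decmx U e *m decmx U g *m (X *m X)) <=
  \tr (decmx U e *m X *m decmx U g *m X).
Proof.
move=> uU hX eg.
have -> : \tr (decmx U e *m decmx U g *m (X *m X)) =
    \tr (decmx U (fun i => e i * g i) *m X *m decmx U (fun=> 1) *m X).
  by rewrite decmxM// decmx1// mulmx1 mulmxA.
rewrite !mxtrace_decmx_conj// lecR.
under eq_bigr => i _ do under eq_bigr => j _ do rewrite mulr1.
apply: chebyshev_sum => // i j; first exact: normc2_ge0.
rewrite -normc2_conj; congr normc2.
have hY : (U *m X *m U^t*)^t* =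
  U *m X *m U^t* by rewrite !adjmxM trmxCK hX mulmxA.
by rewrite -{2}hY; move: (U *m X *m U^t*) => Y; rewrite !mxE.
Qed.

Lemma ando_zhan_summand n (U A : 'M[C]_n) (l e : 'I_n -> R) (p eps : R) :
  U \is unitarymx -> (forall i, 0 <= l i) -> psdmx A -> psdmx (decmx U l - A) ->
  0 < p <= 1 -> 0 < eps -> (forall i, 0 <= e i) ->
  (forall i j, l i <= l j -> e i <= e j) ->
  \tr (decmx U e *m decmx U (fun i => (l i + eps) `^ (p - 1)) *m A) <=
  \tr (decmx U e *m funcalc (fun t => t `^ p) A).
Proof.
move=> uU l0 pA pB p01 e0 pe mono; have /andP[p0 p1] := p01.
have [V [k [uV k0 eA]]] := psd_decmx pA.
pose a := decmx V (fun i => Num.sqrt (k i)).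
have ha : a^t* = a by exact: decmx_adj.
have eaa : A = a *m a.
  by rewrite eA decmxM//; apply: eq_decmx => i; rewrite -expr2 sqr_sqrtr.
pose G := decmx U (fun i => (l i + eps) `^ (p - 1)).
apply: (@le_trans _ _ (\tr (decmx U e *m a *m G *m a))).
  rewrite eaa; apply: mxtrace_antitone_le => // i j.
  have le0 x : 0 < l x + eps by rewrite ltr_wpDl.
  have [ij|/ltW ij] := leP (l i) (l j).
    rewrite mulr_le0// subr_le0; first exact: mono.
    by apply: lef_powR_le0; rewrite ?subr_le0 ?lerD2r.
  rewrite mulr_ge0// subr_ge0; first exact: mono.
  by apply: lef_powR_le0; rewrite ?subr_le0 ?lerD2r.
have k1 i : 0 < k i + eps by rewrite ltr_wpDl.
have l1 i : 0 < l i + eps by rewrite ltr_wpDl.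
(* The shift makes all eigenvalues positive, as Loewner-Heinz requires, and leaves the difference
   [decmx U l - A] unchanged. *)
have kl : psdmx (decmx U (fun i => l i + eps) - decmx V (fun i => k i + eps)).
  rewrite -(decmxD U l (fun=> eps)) -(decmxD V k (fun=> eps)).
  rewrite (decmx_const eps uU) (decmx_const eps uV) -eA.
  have addKB (P Q S : 'M[C]_n) : P + S - (Q + S) = P - Q.
    by rewrite opprD addrACA subrr addr0.
  by rewrite addKB; exact: pB.
have q01 : 0 <= 1 - p <= 1 by rewrite subr_ge0 p1 gerBl ltW.
have ep : - (1 - p) = p - 1 by rewrite opprB.
have := loewner_heinz_neg uV uU k1 l1 kl q01; rewrite ep -/G => LH.
pose K := decmx V (fun i => Num.sqrt (k i) * (k i + eps) `^ (p - 1) * Num.sqrt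
  (k i)).
have aKa : a *m decmx V (fun i => (k i + eps) `^ (p - 1)) *m a = K.
  by rewrite (decmxM _ _ uV) (decmxM _ _ uV).
(* [K] is a function of [A], so this is the scalar bound k (k + eps)^(p-1) <= k^p. *)
have pK : psdmx (decmx V (fun i => k i `^ p) - K).
  rewrite /K decmxB; apply: psdmx_decmx => i.
  rewrite subr_ge0 mulrAC -expr2 sqr_sqrtr// mulrC.
  by rewrite mulrC; exact: powR_shift_le.
have -> : funcalc (fun t => t `^ p) A = decmx V (fun i => k i `^ p).
  by rewrite eA funcalc_decmx.
have pE : psdmx (decmx U e) by exact: psdmx_decmx.
clearbody G a K; move: (decmx V (fun i => k i `^ p)) pK => W pK.
move: (decmx U e) pE => E pE.
have {LH} := psdmx_conj a LH; rewrite ha mulmxBr mulmxBl aKa => LH.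
have -> : \tr (E *m a *m G *m a) = \tr (E *m (a *m G *m a)) by rewrite !mulmxA.
rewrite -subr_ge0 -linearB/= -mulmxBr; apply: psdmx_trM_ge0 pE _.
by have := psdmxD pK LH; rewrite addrA subrK.
Qed.

Lemma psd_funcalc_powR n (p : R) (A : 'M[C]_n) : psdmx A ->
  psdmx (funcalc (fun t => t `^ p) A).
Proof.
move=> /psd_decmx[U [l [uU _ ->]]]; rewrite funcalc_decmx//.
by apply: psdmx_decmx => i; exact: powR_ge0.
Qed.

Lemma excess_powR_subadd n (p s : R) (A B : 'M[C]_n) :
  0 < p <= 1 -> psdmx A -> psdmx B ->
  excess s (funcalc (fun t => t `^ p) (A + B)) <=
  excess s (funcalc (fun t => t `^ p) A + funcalc (fun t => t `^ p) B).
Proof.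
move=> p01 pA pB; have /andP[p0 p1] := p01.
have [U [l [uU l0 eZ]]] := psd_decmx (psdmxD pA pB).
set Ap := funcalc _ A; set Bp := funcalc _ B.
have pAp : psdmx Ap by exact: psd_funcalc_powR.
have pBp : psdmx Bp by exact: psd_funcalc_powR.
rewrite eZ funcalc_decmx//.
(* [e] gives the projection attaining the excess of the [p]-th power of [A + B]; it is nondecreasing
   in [l]. *)
pose e i : R := (s < l i `^ p)%R%:R.
have [eE xE] := excess_attained s (fun i => l i `^ p) uU.
rewrite -/e in eE xE.
rewrite -lecR xE.
apply: le_trans (le_excess s (psd_herm (psdmxD pAp pBp)) eE).
rewrite lerD2r decmxM// mxtrace_decmx//.
have e0 i : 0 <= e i by exact: ler0n.
have mono i j : l i <= l j -> e i <= e j.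
  move=> lij; rewrite /e ler_nat; case: ltP => // si.
  suff -> : s < l j `^ p by [].
  by apply: lt_le_trans si _; rewrite ler_powR_ge0// ltW.
have pE : psdmx (decmx U e) by exact: psdmx_decmx.
have /ger0_real/RRe_real <- := psdmx_trM_ge0 pE (psdmxD pAp pBp).
set t := complex.Re _; rewrite lecR.
(* Replacing l^p by l (l + eps)^(p-1) costs at most eps^p per selected eigenvalue; the trace then
   splits along [A + B]. *)
have key eps : 0 < eps -> \sum_i e i * l i `^ p <= t + (\sum_i e i) * eps `^ p.
  move=> eps0; pose g i := (l i + eps) `^ (p - 1).
  apply: (@le_trans _ _ (\sum_i (e i * g i * l i) + (\sum_i e i) * eps `^ p)).
    rewrite mulr_suml -big_split/=; apply: ler_sum => i _.
    rewrite -mulrA -mulrDr ler_wpM2l// [g i * _]mulrC.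
    exact: powR_shift_ge.
  rewrite lerD2r -lecR.
  have /ger0_real/RRe_real -> := psdmx_trM_ge0 pE (psdmxD pAp pBp).
  rewrite -(mxtrace_decmx _ uU) -(decmxM _ _ uU) -(decmxM _ _ uU) -eZ.
  have trD (M P Q : 'M[C]_n) : \tr (M *m (P + Q)) = \tr (M *m P) + \tr (M *m Q).
    by rewrite mulmxDr mxtraceD.
  rewrite !trD; apply: lerD.
    have pB' : psdmx (decmx U l - A) by rewrite -eZ addrC addKr.
    exact: ando_zhan_summand uU l0 pA pB' p01 eps0 e0 mono.
  have pA' : psdmx (decmx U l - B) by rewrite -eZ addrK.
  exact: ando_zhan_summand uU l0 pB pA' p01 eps0 e0 mono.
apply/ler_addgt0Pr => d d0.
set c := \sum_i e i in key.
have c0 : 0 <= c by apply: sumr_ge0.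
have c1 : 0 < c + 1 by rewrite ltr_wpDl.
(* This choice gives (c + 1) eps^p = d, and the added 1 covers the case [c = 0]. *)
apply: le_trans (key ((d / (c + 1)) `^ p^-1) _) _.
  by rewrite powR_gt0// divr_gt0.
rewrite lerD2l -powRrM mulVf ?gt_eqF// powRr1; last by rewrite divr_ge0 ?ltW.
rewrite mulrCA; apply: ler_piMr; first exact: ltW.
by rewrite ler_pdivrMr// mul1r lerDl.
Qed.

End Subadditivity.

(** * Weyl's monotonicity and powers of the absolute value of a sum *)

Section Weyl.
Variable R : realType.
Notation C := R[i].

Lemma sort_ord n (l : 'I_n -> R) :
  exists s : 'S_n, forall i j : 'I_n, (i <= j)%N -> l (s j) <= l (s i).
Proof.
pose t := [tuple l i | i < n].
have geT : total (fun x y : R => y <= x) by move=> x y; exact: le_total.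
have geTr : transitive (fun x y : R => y <= x) by move=> y x z xy yz;
  exact: le_trans yz xy.
have /tuple_permP[s es] : perm_eq (sort_tuple (fun x y : R => y <= x) t) t.
  by rewrite perm_sort.
exists s => i j ij.
have tE k : nth 0 (sort (fun x y : R => y <= x) t) k =
  nth 0 [tuple tnth t (s i) | i < n] k.
  by rewrite -es.
have lE (k : 'I_n) : l (s k) = nth 0 (sort (fun x y : R => y <= x) t) k.
  by rewrite tE -(tnth_nth 0) !tnth_mktuple.
rewrite !lE; apply: (sorted_leq_nth geTr _ 0 (sort_sorted geT t)) => //.
- rewrite inE size_sort size_map size_enum_ord; exact: ltn_ord.
- rewrite inE size_sort size_map size_enum_ord; exact: ltn_ord.
Qed.

Lemma decmx_perm n (U : 'M[C]_n) (l : 'I_n -> R) (s : 'S_n) :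
  decmx (row_perm s U) (fun i => l (s i)) = decmx U l.
Proof.
rewrite decmx.unlock /rdiag_mx; apply/matrixP => i j.
rewrite !mul_mx_diag !mxE.
rewrite [RHS](reindex_inj (@perm_inj _ s))/=.
by apply: eq_bigr => k _; rewrite !mxE.
Qed.

Lemma unitarymx_row_perm n (U : 'M[C]_n) (s : 'S_n) :
  U \is unitarymx -> row_perm s U \is unitarymx.
Proof.
move=> /unitarymxP uU; apply/unitarymxP/matrixP => i j.
have /matrixP/(_ (s i) (s j)) := uU; rewrite !mxE (inj_eq perm_inj) => <-.
by apply: eq_bigr => k _; rewrite !mxE.
Qed.

Lemma decmx_sorted n (U : 'M[C]_n) (l : 'I_n -> R) : U \is unitarymx ->
  exists V k s, [/\ V \is unitarymx, decmx U l = decmx V k,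
    (forall i j : 'I_n, (i <= j)%N -> k j <= k i) &
    forall i, k i = l (fun_of_perm s i)].
Proof.
move=> uU; have [s sl] := sort_ord l.
exists (row_perm s U), (fun i => l (s i)), s.
split; [exact: unitarymx_row_perm|by rewrite decmx_perm|exact: sl|by []].
Qed.

Lemma sum_normc2_unitary n (U : 'M[C]_n) (v : 'rV[C]_n) : U \is unitarymx ->
  (\sum_i normc2 ((v *m U^t*) 0 i))%:C = (v *m v^t*) 0 0.
Proof.
move=> uU; have := decmx_formR U (fun=> 1) v; rewrite decmx1// mulmx1 => ->.
by congr _%:C; apply: eq_bigr => i _; rewrite mul1r.
Qed.

(* A vector orthogonal to the first [k] rows of [V] and to the rows of [U]
   following the [k]-th one satisfies [n - 1] linear equations. *)
Lemma weyl_monotone n (U V : 'M[C]_n) (x y : 'I_n -> R) :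
  U \is unitarymx -> V \is unitarymx ->
  (forall i j : 'I_n, (i <= j)%N -> x j <= x i) ->
  (forall i j : 'I_n, (i <= j)%N -> y j <= y i) ->
  psdmx (decmx V y - decmx U x) -> forall k, x k <= y k.
Proof.
move=> uU uV sx sy [_ pYX] k.
(* Column [k] is left zero, which makes [M] singular and yields [v]. *)
pose M := \matrix_(i, j) (if (j < k)%N then (V^t*) i j
   else if (k < j)%N then (U^t*) i j else 0) : 'M[C]_n.
have Mk : M *m delta_mx k 0 = 0 :> 'cV_n.
  by rewrite -colE; apply/colP => i; rewrite !mxE ltnn.
have /det0P[v v0 vM] : \det M == 0.
  rewrite -[_ == 0]negbK; apply/negP => dM.
  have uM : M \in unitmx by rewrite unitmxE unitfE.
  have := congr1 (mulmx (invmx M)) Mk;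
    rewrite mulKmx// mulmx0 => /matrixP/(_ k 0).
  by rewrite !mxE !eqxx => /eqP; rewrite oner_eq0.
have vMj j : (v *m M) 0 j = 0 by rewrite vM mxE.
have vV (j : 'I_n) : (j < k)%N -> (v *m V^t*) 0 j = 0.
  move=> jk; rewrite -(vMj j) !mxE; apply: eq_bigr => i _.
  by rewrite [M i j]mxE jk.
have vU (j : 'I_n) : (k < j)%N -> (v *m U^t*) 0 j = 0.
  move=> kj; rewrite -(vMj j) !mxE; apply: eq_bigr => i _.
  by rewrite [M i j]mxE kj ltnNge (ltnW kj).
have n0 : normc2 (0 : C) = 0 by rewrite /normc2/= !expr0n addr0.
pose w := \sum_i normc2 ((v *m U^t*) 0 i).
have wV : w = \sum_i normc2 ((v *m V^t*) 0 i).
  by apply: complexI; rewrite (sum_normc2_unitary _ uU) (sum_normc2_unitary _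
    uV).
have w0 : 0 < w.
  by rewrite -ltcR (sum_normc2_unitary _ uU) -dotmxE; exact: dotmx_is_dotmx.
have := pYX v; rewrite mulmxBr mulmxBl [X in _ <= X]mxE [X in _ + X]mxE.
rewrite !decmx_formR -rmorphB ler0c subr_ge0 => xy.
rewrite -(ler_pM2r w0).
apply: (@le_trans _ _ (\sum_i x i * normc2 ((v *m U^t*) 0 i))).
  rewrite mulr_sumr; apply: ler_sum => i _.
  have [ik|ki] := leqP i k; first by rewrite ler_wpM2r ?normc2_ge0 ?sx.
  by rewrite (vU _ ki) n0 !mulr0.
apply: (le_trans xy).
rewrite wV mulr_sumr; apply: ler_sum => i _.
have [ki|ik] := leqP k i; first by rewrite ler_wpM2r ?normc2_ge0 ?sy.
by rewrite (vV _ ik) n0 !mulr0.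
Qed.

(** Once both spectra are sorted, the comparison holds term by term. *)
Lemma sum_monotone_le n (U V : 'M[C]_n) (x y : 'I_n -> R) (psi : R -> R) :
  U \is unitarymx -> V \is unitarymx -> {homo psi : a b / a <= b} ->
  psdmx (decmx V y - decmx U x) -> \sum_i psi (x i) <= \sum_i psi (y i).
Proof.
move=> uU uV hpsi.
have [U' [x' [s [uU' -> sx ex]]]] := decmx_sorted x uU.
have [V' [y' [t [uV' -> sy ey]]]] := decmx_sorted y uV => pYX.
rewrite (reindex_inj (@perm_inj _ s)) [leRHS](reindex_inj (@perm_inj _ t))/=.
apply: ler_sum => i _; rewrite -ex -ey; apply: hpsi.
exact: (weyl_monotone uU' uV' sx sy pYX).
Qed.

Lemma abspowmx_decmx n (U : 'M[C]_n) (h : 'I_n ->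
  R) (p : R) : U \is unitarymx ->
  abspowmx p (decmx U h) = decmx U (fun i => `|h i| `^ p).
Proof.
move=> uU; rewrite /abspowmx /absmx decmx_adj decmxM// !funcalc_decmx//.
by apply: eq_decmx => i; rewrite -expr2 sqrtr_sqr.
Qed.

(** An eigenvalue [h] of [P - Q] counts either through [h] or through [- h]. The two resulting sums
    are bounded using [P - Q <= P] and [Q - P <= Q]. *)
Lemma excess_abspow_sub n (p s : R) (P Q : 'M[C]_n) :
  0 < p -> 0 <= s -> psdmx P -> psdmx Q ->
  excess s (abspowmx p (P - Q)) <=
  excess s (funcalc (fun t => t `^ p) P) + excess s (funcalc (fun t =>
    t `^ p) Q).
Proof.
move=> p0 s0 pP pQ.
have [U [a [uU a0 eP]]] := psd_decmx pP.
have [V [b [uV b0 eQ]]] := psd_decmx pQ.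
have [W [h [uW eH]]] : exists W h, W \is unitarymx /\ P - Q = decmx W h.
  by apply: herm_decmx; rewrite adjmxB (psd_herm pP) (psd_herm pQ).
rewrite eH abspowmx_decmx// excess_decmx//.
(* Cutting at 0 makes [psi] monotone on the whole line; it vanishes for [t <= 0] because 0^p = 0 and
   [s >= 0]. *)
pose psi (t : R) := Num.max (Num.max t 0 `^ p - s) 0.
have hpsi : {homo psi : x y / x <= y}.
  move=> x y xy; rewrite /psi ge_max !le_max lexx orbT andbT lerD2r.
  apply/orP; left; apply: ler_powR_ge0; first exact: ltW.
    by rewrite le_max lexx orbT.
  by rewrite ge_max !le_max xy lexx orbT.
have psi0 t : t <= 0 -> psi t = 0.
  move=> t0; rewrite /psi (max_r t0) powR0 ?gt_eqF// sub0r max_r// oppr_le0//.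
have psip t : 0 <= t -> psi t = Num.max (t `^ p - s) 0.
  by move=> t0; rewrite /psi (max_l t0).
have -> : \sum_i Num.max (`|h i| `^ p - s) 0 =
  \sum_i psi (h i) + \sum_i psi (- h i).
  rewrite -big_split/=; apply: eq_bigr => i _.
  have [hi|/ltW hi] := leP 0 (h i).
    by rewrite psip// [psi (- _)]psi0 ?oppr_le0// addr0 ger0_norm.
  by rewrite psi0// [psi (- _)]psip ?oppr_ge0// add0r ler0_norm.
have excess_psi W' (c : 'I_n -> R) : W' \is unitarymx -> (forall i, 0 <= c i) ->
    excess s (funcalc (fun t => t `^ p) (decmx W' c)) = \sum_i psi (c i).
  move=> uW' c0; rewrite (funcalc_decmx _ _ uW') (excess_decmx _ _ uW').
  by apply: eq_bigr => i _; rewrite (psip _ (c0 i)).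
rewrite eP eQ (excess_psi _ _ uU a0) (excess_psi _ _ uV b0); apply: lerD.
  apply: (sum_monotone_le uW uU hpsi); rewrite -eH -eP.
  by have -> : P - (P - Q) = Q by rewrite opprB addrCA subrr addr0.
apply: (sum_monotone_le (x := fun i => - h i) uW uV hpsi).
rewrite -decmxN -eH -eQ.
by have -> : Q - - (P - Q) = P by rewrite opprK addrC subrK.
Qed.

Lemma decmx_posneg n (U : 'M[C]_n) (h : 'I_n -> R) :
  decmx U h = decmx U (fun i => Num.max (h i) 0) - decmx U (fun i =>
    Num.max (- h i) 0).
Proof.
rewrite decmxB; apply: eq_decmx => i.
have [hi|/ltW hi] := leP 0 (h i).
  by rewrite (max_r (x := - h i)) ?oppr_le0// subr0.
by rewrite (max_l (x := - h i)) ?oppr_ge0// opprK add0r.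
Qed.

Lemma excess_abspow_add n (p s : R) (S T : 'M[C]_n) :
  0 < p <= 1 -> 0 <= s -> S^t* = S -> T^t* = T ->
  excess s (abspowmx p (S + T)) <= excess s (abspowmx p S + abspowmx p T).
Proof.
move=> p01 s0 /herm_decmx[U [a [uU eS]]] /herm_decmx[V [b [uV eT]]].
have /andP[p0 _] := p01; rewrite eS eT.
(* Positive and negative parts: at each eigenvalue one of them is 0, and 0^p = 0 for [p > 0], so the
   powers simply add. *)
have half W (h : 'I_n -> R) : W \is unitarymx -> exists P Q,
    [/\ psdmx P, psdmx Q, decmx W h = P - Q & abspowmx p (decmx W h) =
        funcalc (fun t => t `^ p) P + funcalc (fun t => t `^ p) Q].
  move=> uW; exists (decmx W (fun i => Num.max (h i) 0)).
  exists (decmx W (fun i => Num.max (- h i) 0)).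
  split; [| |exact: decmx_posneg|].
  - by apply: psdmx_decmx => i; rewrite le_max lexx orbT.
  - by apply: psdmx_decmx => i; rewrite le_max lexx orbT.
  rewrite abspowmx_decmx// !funcalc_decmx// decmxD; apply: eq_decmx => i.
  have [hi|/ltW hi] := leP 0 (h i).
    by rewrite ger0_norm// (max_r (x := - h i)) ?oppr_le0// powR0 ?gt_eqF//
      addr0.
  by rewrite ler0_norm// (max_l (x := - h i)) ?oppr_ge0// powR0 ?gt_eqF// add0r.
have [P1 [Q1 [pP1 pQ1 eS1 ->]]] := half U a uU.
have [P2 [Q2 [pP2 pQ2 eT1 ->]]] := half V b uV.
have -> : decmx U a + decmx V b = (P1 + P2) - (Q1 + Q2).
  by rewrite eS1 eT1 opprD addrACA.
have pS := psdmxD pP1 pP2; have pT := psdmxD pQ1 pQ2.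
apply: le_trans (excess_abspow_sub p0 s0 pS pT) _.
have := lerD (excess_powR_subadd s p01 pP1 pP2) (excess_powR_subadd s p01 pQ1
  pQ2).
move=> /le_trans; apply.
rewrite addrACA; apply: excess_superadd s0 _ _;
  by apply: psdmxD; exact: psd_funcalc_powR.
Qed.

End Weyl.

(** * Weak majorization and Fan dominance *)

Section FanDominance.
Variable R : realType.
Notation C := R[i].

(** At a level [s] separating the first [k] values of [y] from the others, the excess of [y] is
    exactly the prefix sum of [y - s], while that of [x] dominates its prefix sum. *)
Lemma excess_prefix n (x y : 'I_n -> R) :
  (forall i, 0 <= y i) -> (forall i j : 'I_n, (i <= j)%N -> y j <= y i) ->
  (forall s, 0 <= s -> \sum_i Num.max (x i - s) 0 <=
    \sum_i Num.max (y i - s) 0) ->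
  forall k : nat, \sum_(i < n | (i < k)%N) x i <= \sum_(i < n | (i < k)%N) y i.
Proof.
move=> y0 sy xy k.
have [s [s0 sl sg]] : exists s, [/\ 0 <= s, forall i : 'I_n, (i < k)%N ->
  s <= y i &
    forall i : 'I_n, (k <= i)%N -> y i <= s].
  (* Indices start at 0, so [y k] is the largest value outside the prefix; for a full prefix the
     level 0 works. *)
  have [kn|nk] := ltnP k n.
    exists (y (Ordinal kn)); split=> // i ik; apply: sy => //; exact: ltnW.
  by exists 0; split=> // i ki; have := leq_trans (ltn_ord i) nk;
    rewrite ltnNge ki.
suff : \sum_(i < n | (i < k)%N) (x i - s) <= \sum_(i < n | (i < k)%N) (y i - s).
  by rewrite !sumrB lerD2r.
apply: (@le_trans _ _ (\sum_i Num.max (x i - s) 0)).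
  rewrite [leRHS](bigID (fun i : 'I_n => (i < k)%N))/= -[leLHS]addr0;
    apply: lerD.
    by apply: ler_sum => i _; rewrite le_max lexx.
  by apply: sumr_ge0 => i _; rewrite le_max lexx orbT.
apply: (le_trans (xy s s0)).
rewrite (bigID (fun i : 'I_n => (i < k)%N))/= [X in _ + X]big1 ?addr0.
  by apply: ler_sum => i ik; rewrite max_l// subr_ge0 sl.
by move=> i; rewrite -leqNgt => ki; rewrite max_r// subr_le0 sg.
Qed.

(* Each step of the induction makes [y] agree with [x] at one more index,
   either by a transfer between two coordinates of [y] (a convex combination of
   [y] and a transposition of [y]), or, when [x <= y], by shrinking one
   coordinate (a convex combination of [y] and a sign change of [y]). *)
Lemma weak_majorization_gauge n (nu : ('I_n -> R) -> R) (x : 'I_n -> R) :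
  (forall u v, u =1 v -> nu u = nu v) ->
  (forall t u v, 0 <= t <= 1 ->
     nu (fun i => (1 - t) * u i + t * v i) <= (1 - t) * nu u + t * nu v) ->
  (forall u (s : 'S_n), nu (fun i => u (s i)) = nu u) ->
  (forall u k, nu (fun i => if i == k then - u i else u i) = nu u) ->
  (forall i, 0 <= x i) -> (forall i j : 'I_n, (i <= j)%N -> x j <= x i) ->
  forall y, (forall k : nat, \sum_(i < n | (i < k)%N) x i <=
    \sum_(i < n | (i < k)%N) y i) ->
  nu x <= nu y.
Proof.
move=> nuE nu_conv nu_perm nu_flip x0 sx y.
have [N] := ubnP #|[pred i | x i != y i]|.
elim: N y => // N IH y; rewrite ltnS => cN xy.
have step y' (t : R) (v : 'I_n -> R) i : 0 <= t <= 1 -> nu v = nu y ->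
    (forall l, y' l = (1 - t) * y l + t * v l) -> x i != y i -> x i = y' i ->
    (forall l, x l = y l -> x l = y' l) ->
    (forall k : nat, \sum_(i < n | (i < k)%N) x i <=
      \sum_(i < n | (i < k)%N) y' i) ->
    nu x <= nu y.
  move=> t01 nuv y'E xi xi' agree xy'.
  have le1 : nu y' <= nu y.
    rewrite (nuE _ _ y'E); apply: le_trans (nu_conv _ _ _ t01) _.
    by rewrite nuv -mulrDl subrK mul1r.
  apply: le_trans le1; apply: IH xy'.
  apply: leq_trans cN; apply: proper_card; apply/properP; split.
    by apply/fintype.subsetP => l; rewrite !inE;
      apply: contra => /eqP/agree/eqP.
  by exists i; rewrite !inE// negbK; apply/eqP.
have [/existsP[j0 j0P]|/existsPn noj] := boolP [exists j, y j < x j];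
  last first.
  have lexy i : x i <= y i by rewrite leNgt noj.
  have [/existsP[i xyi]|/existsPn noi] := boolP [exists i, x i != y i];
    last first.
    by rewrite (nuE x y)// => i; apply/eqP; rewrite -[_ == _]negbK noi.
  have yi0 : 0 < y i by rewrite (le_lt_trans (x0 i))// lt_neqAle xyi lexy.
  pose y' l := if l == i then x i else y l.
  (* The weight [t] solves [(1 - t) * y i - t * y i = x i]. *)
  apply: (step y' ((1 - x i / y i) / 2) (fun l =>
    if l == i then - y l else y l) i) => //.
  - have h0 : 0 <= x i / y i by rewrite divr_ge0// ltW.
    have h1 : x i / y i <= 1 by rewrite ler_pdivrMr// mul1r.
    by apply/andP; split; lra.
  - move=> l; rewrite /y'; case: eqP => [->|_]; last by ring.
    by field; rewrite gt_eqF.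
  - by rewrite /y' eqxx.
  - by move=> l xl; rewrite /y'; case: eqP => [->|].
  - by move=> k; apply: ler_sum => l _; rewrite /y'; case: eqP => [->|].
(* At the first deficit [j], the prefix inequality for [j.+1] forces a surplus at some earlier
   [i]. *)
have [j jP jmin] := @arg_minnP _ j0 (fun j => y j < x j) (fun j => j : nat) j0P.
have lt_j (l : 'I_n) : (l < j)%N -> x l <= y l.
  by move=> lj; rewrite leNgt; apply/negP => /jmin; rewrite leqNgt lj.
have [i ij xyi] : exists2 i : 'I_n, (i < j)%N & x i < y i.
  apply: contrapT => noi; have := xy j.+1.
  rewrite leNgt => /negP; apply.
  rewrite (bigD1 j)//= [ltRHS](bigD1 j)//= ltr_leD//.
  apply: ler_sum => l /andP[lj ljn]; rewrite leNgt; apply/negP => xyl.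
  by apply: noi; exists l => //; rewrite ltn_neqAle ljn -ltnS.
have ijn : i != j by rewrite neq_ltn ij.
have xij := sx i j (ltnW ij).
(* The largest transfer from [i] to [j] that overshoots neither target; it reaches [x] at [i] or at
   [j], recorded by [i0]. *)
pose d := Num.min (y i - x i) (x j - y j).
have d0 : 0 < d by rewrite lt_min !subr_gt0 xyi jP.
have di : d <= y i - x i by rewrite ge_min lexx.
have dj : d <= x j - y j by rewrite ge_min lexx orbT.
have yij : 0 < y i - y j by lra.
pose y' l := if l == i then y i - d else if l == j then y j + d else y l.
pose i0 := if y i - x i <= x j - y j then i else j.
apply: (step y' (d / (y i - y j)) (fun l => y (tperm i j l)) i0) => //.
- apply/andP; split; first by rewrite divr_ge0// ltW.
  by rewrite ler_pdivrMr// mul1r; lra.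
- move=> l; rewrite /y'; case: (eqVneq l i) => [->|li].
    by rewrite tpermL; field; rewrite gt_eqF.
  case: (eqVneq l j) => [->|lj]; first by rewrite tpermR; field; rewrite gt_eqF.
  by rewrite tpermD 1?eq_sym//; ring.
- by rewrite /i0; case: ifP => _; rewrite ?(lt_eqF xyi)// gt_eqF.
- rewrite /i0 /y' /d; case: leP => h; first by rewrite eqxx opprB addrC subrK.
  by rewrite eq_sym (negbTE ijn) eqxx addrC subrK.
- move=> l xl; rewrite /y'; case: eqP => [li|_]; first by move: xyi;
  rewrite -li xl ltxx.
  by case: eqP => // lj; move: jP; rewrite -lj xl ltxx.
(* Up to [j] the terms of [y'] still dominate those of [x]; beyond [j] the prefix contains both ends
   of the transfer, so its sum is unchanged. *)
move=> k; have [kj|jk] := leqP k j.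
  apply: ler_sum => l lk; have lj := leq_trans lk kj.
  rewrite /y'; case: eqP => [->|_]; first by lra.
  by case: eqP => [lj'|_]; [move: lj; rewrite lj' ltnn|exact: lt_j].
apply: le_trans (xy k) _; rewrite le_eqVlt; apply/orP; left; apply/eqP.
have ik := ltn_trans ij jk.
rewrite (bigD1 i)//= (bigD1 j) ?jk 1?eq_sym//=.
rewrite [RHS](bigD1 i)//= [X in _ = _ + X](bigD1 j) ?jk 1?eq_sym//=.
rewrite /y' eqxx eq_sym (negbTE ijn) eqxx !addrA; congr (_ + _); first by lra.
by apply: eq_bigr => l /andP[/andP[_ li] lj]; rewrite (negbTE li) (negbTE lj).
Qed.

Lemma unitarymx1 n : (1%:M : 'M[C]_n) \is unitarymx.
Proof. by apply/unitarymxP; rewrite adjmx1 mulmx1. Qed.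

Lemma symmetric_norm_decmx n (N : 'M[C]_n -> R) (U : 'M[C]_n) (l : 'I_n -> R) :
  symmetric_norm N -> U \is unitarymx -> N (decmx U l) = N (decmx 1%:M l).
Proof.
move=> [_ Ninv] uU; rewrite -(Ninv (U^t*) (decmx 1%:M l) U) ?trmxC_unitary//.
by rewrite decmx.unlock adjmx1 mul1mx mulmx1.
Qed.

(** On real diagonal matrices [N] is a symmetric gauge function: convex by the norm axioms, and
    invariant under permutations and sign changes by unitary invariance. *)
Lemma fan_dominance n (N : 'M[C]_n -> R) (X Y : 'M[C]_n) :
  symmetric_norm N -> psdmx X -> psdmx Y ->
  (forall s, 0 <= s -> excess s X <= excess s Y) -> N X <= N Y.
Proof.
move=> hN pX pY; have [[_ _ Nhom Ntri] Ninv] := hN.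
have sorted (Z : 'M[C]_n) : psdmx Z ->
  exists V k, [/\ V \is unitarymx, Z = decmx V k,
    forall i, 0 <= k i & forall i j : 'I_n, (i <= j)%N -> k j <= k i].
  move=> /psd_decmx[U [l [uU l0 ->]]].
  have [V [k [s [uV -> sk ek]]]] := decmx_sorted l uU.
  by exists V, k; split=> [|//|i|]; rewrite ?ek.
have [U [x [uU -> x0 sx]]] := sorted X pX.
have [V [y [uV -> y0 sy]]] := sorted Y pY => xy.
rewrite (symmetric_norm_decmx _ hN uU) (symmetric_norm_decmx _ hN uV).
have Nscale (c : R) Z : 0 <= c -> N (c%:C *: Z) = c * N Z.
  by move=> c0; apply: complexI; rewrite Nhom rmorphM ger0_norm// ler0c.
have scale_decmx (c : R) (l : 'I_n -> R) :
    decmx 1%:M (fun i => c * l i) = c%:C *: decmx 1%:M l.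
  rewrite -mul_scalar_mx -(decmx_const c (unitarymx1 n)).
  by rewrite (decmxM _ _ (unitarymx1 n)).
apply: (@weak_majorization_gauge n (fun l => N (decmx 1%:M l))) => //.
- by move=> u v uv; congr N; exact: eq_decmx.
- move=> t u v /andP[t0 t1];
  rewrite -(decmxD _ (fun i => (1 - t) * u i) (fun i => t * v i)).
  by rewrite !scale_decmx (le_trans (Ntri _ _))// !Nscale// subr_ge0.
- move=> u s; rewrite -(symmetric_norm_decmx _ hN (unitarymx_row_perm s
  (unitarymx1 n))).
  by rewrite decmx_perm.
(* A sign change is multiplication by the diagonal unitary with entry -1 at [k]. *)
- move=> u k; pose e i : R := if i == k then -1 else 1.
  have uE : decmx 1%:M e \is unitarymx.
    apply/unitarymxP; rewrite decmx_adj (decmxM _ _ (unitarymx1 n))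
      -[RHS](decmx1 (unitarymx1 n)).
    by apply: eq_decmx => i; rewrite /e; case: eqP; rewrite ?mulrNN mulr1.
  rewrite -[RHS](Ninv _ _ _ uE (unitarymx1 n)) mulmx1 (decmxM _ _ (unitarymx1
    n)).
  by congr N; apply: eq_decmx => i; rewrite /e; case: eqP;
    rewrite ?mulN1r ?mul1r.
- by apply: excess_prefix y0 sy _ => s s0; have := xy s s0;
  rewrite (excess_decmx _ _ uU) (excess_decmx _ _ uV).
Qed.

End FanDominance.

(** * Absolute values of block matrices *)

Section Blocks.
Variable R : realType.
Notation C := R[i].

Lemma funcalc_block m n (f : R -> R) (X : 'M[C]_m) (Y : 'M[C]_n) :
  X^t* = X -> Y^t* = Y ->
  funcalc f (block_mx X 0 0 Y) = block_mx (funcalc f X) 0 0 (funcalc f Y).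
Proof.
move=> /herm_decmx[U [l [uU ->]]] /herm_decmx[V [k [uV ->]]].
rewrite decmx_block (funcalc_decmx _ _ (unitarymx_block uU uV)).
rewrite (funcalc_decmx _ _ uU) (funcalc_decmx _ _ uV) decmx_block.
by apply: eq_decmx => i; case: fintype.split.
Qed.

Lemma gram_herm n (X : 'M[C]_n) : (X^t* *m X)^t* = X^t* *m X.
Proof. by rewrite adjmxM trmxCK. Qed.

Lemma psd_absmx n (X : 'M[C]_n) : psdmx (absmx X).
Proof.
have [U [l [uU eX]]] := herm_decmx (gram_herm X).
rewrite /absmx eX (funcalc_decmx _ _ uU).
by apply: psdmx_decmx => i; exact: sqrtr_ge0.
Qed.

Lemma psd_abspowmx n (p : R) (X : 'M[C]_n) : psdmx (abspowmx p X).
Proof. exact/psd_funcalc_powR/psd_absmx. Qed.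

Lemma abspowmx0 n (X : 'M[C]_n) : abspowmx 0 X = 1%:M.
Proof.
have [U [l [uU eX]]] := herm_decmx (psd_herm (psd_absmx X)).
rewrite /abspowmx eX (funcalc_decmx _ _ uU) -(decmx1 uU).
by apply: eq_decmx => i; rewrite powRr0.
Qed.

Lemma abspowmx_diag_block m n (p : R) (A : 'M[C]_m) (D : 'M[C]_n) :
  abspowmx p (block_mx A 0 0 D) = block_mx (abspowmx p A) 0 0 (abspowmx p D).
Proof.
have e : absmx (block_mx A 0 0 D) = block_mx (absmx A) 0 0 (absmx D).
  rewrite -(funcalc_block _ (gram_herm A) (gram_herm D)) /absmx; congr funcalc.
  rewrite adjmx_block !trmx0 !map_mx0 mulmx_block.
  by rewrite !(mulmx0, mul0mx, addr0, add0r).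
rewrite /abspowmx e.
exact: (funcalc_block _ (psd_herm (psd_absmx A)) (psd_herm (psd_absmx D))).
Qed.

(** The antidiagonal matrix is Hermitian and its square is block diagonal, with blocks [B^t* *m B]
    and [B *m B^t*]. *)
Lemma abspowmx_antidiag_block n (p : R) (B : 'M[C]_n) :
  abspowmx p (block_mx 0 (B^t*) B 0) =
    block_mx (abspowmx p B) 0 0 (abspowmx p (B^t*)).
Proof.
have e : absmx (block_mx 0 (B^t*) B 0) = block_mx (absmx B) 0 0 (absmx (B^t*)).
  rewrite -(funcalc_block _ (gram_herm B) (gram_herm (B^t*))) /absmx;
    congr funcalc.
  rewrite adjmx_block !trmx0 !map_mx0 trmxCK mulmx_block.
  by rewrite !(mulmx0, mul0mx, addr0, add0r).
rewrite /abspowmx e.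
exact: (funcalc_block _ (psd_herm (psd_absmx B)) (psd_herm (psd_absmx _))).
Qed.

End Blocks.

(** * The norm inequality for Hermitian block matrices *)

Unset Implicit Arguments.

Theorem corollary2p6 (R : realType) (n : nat) (A B C : 'M[R[i]]_n)
    (hH : block_mx A (B^t*) B C \is hermsymmx)
    (N : 'M[R[i]]_(n + n) -> R) (hN : symmetric_norm N)
    (p : R) (hp0 : 0 <= p) (hp1 : p <= 1) :
  N (abspowmx p (block_mx A (B^t*) B C)) <=
  N (padmx (abspowmx p A + abspowmx p B + abspowmx p (B^t*) + abspowmx p C)).
Proof.
have /hermsymmxP := hH; rewrite adjmx_block trmxCK.
move=> /eq_block_mx[hA _ _ hC].
(* The grouping follows the diagonal blocks of the sum of the powers of the diagonal and
   antidiagonal parts. *)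
pose Y1 := abspowmx p A + abspowmx p B;
  pose Y2 := abspowmx p C + abspowmx p (B^t*).
have addrAC4 (P Q S T : 'M[R[i]]_n) : P + Q + S + T = (P + Q) + (T + S).
  by rewrite -addrA (addrC S).
have -> : abspowmx p A + abspowmx p B + abspowmx p (B^t*) + abspowmx p C =
  Y1 + Y2.
  exact: addrAC4.
have pY1 : psdmx Y1 by apply: psdmxD; exact: psd_abspowmx.
have pY2 : psdmx Y2 by apply: psdmxD; exact: psd_abspowmx.
have pY := psdmxD pY1 pY2.
apply: (fan_dominance hN); first exact: psd_abspowmx.
  by apply: psdmx_block pY (@psdmx0 _ _).
move=> s s0; rewrite (excess_padmx s0 (psd_herm pY)).
apply: le_trans (excess_superadd s0 pY1 pY2).
have {hp0} := hp0; rewrite le_eqVlt => /predU1P[p0|p0].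
  rewrite /Y1 /Y2 -p0 !abspowmx0 (scalar_mx_block n n).
  rewrite (excess_block _ (adjmx1 _ n) (adjmx1 _ n)).
  (* For [p = 0] both [Y1] and [Y2] equal [1 + 1], to be compared with one identity block each. *)
  have le1 : excess s (1%:M : 'M[R[i]]_n) <=
    excess s (1%:M + 1%:M : 'M[R[i]]_n).
    apply: le_trans (excess_superadd s0 (@psdmx1 _ n) (@psdmx1 _ n)).
    by rewrite lerDl excess_ge0.
  exact: lerD.
have p01 : 0 < p <= 1 by rewrite p0 hp1.
rewrite -(excess_block s (psd_herm pY1) (psd_herm pY2)).
have -> : block_mx A (B^t*) B C = block_mx A 0 0 C + block_mx 0 (B^t*) B 0.
  by rewrite add_block_mx !addr0 !add0r.
have -> : block_mx Y1 0 0 Y2 =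
    abspowmx p (block_mx A 0 0 C) + abspowmx p (block_mx 0 (B^t*) B 0).
  rewrite abspowmx_diag_block abspowmx_antidiag_block.
  by rewrite add_block_mx !addr0.
apply: excess_abspow_add p01 s0 _ _.
  by rewrite adjmx_block hA hC !trmx0 !map_mx0.
by rewrite adjmx_block trmxCK !trmx0 !map_mx0.
Qed.
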